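(* The well-definedness problem and the semantic type-checking problem for pure PERX are decidable. That is: (1) there is an algorithm which, given a pure PERX expression $e$ and an assignment $\Gamma$ of pure RX-types to the free variables of $e$, decides whether $e(\sigma)$ is defined for every environment $\sigma\in\Gamma$; and (2) there is an algorithm which, given a pure PERX expression $e$, an assignment $\Gamma$ of pure RX-types to the free variables of $e$ such that $e(\sigma)$ is defined for every $\sigma\in\Gamma$, and a pure RX-type $\tau$, decides whether $e(\sigma)\in\tau$ for every environment $\sigma\in\Gamma$.
   Context: **Values.** $\mathcal A$ is an infinite recursively enumerable set of atoms. Nodes are defined inductively: a node is an element node $\langle a:N\rangle$ or a data node $\langle a\rangle$, where $a\in\mathcal A$ and $N$ is a finite set of nodes. An item is an atom or a node. A pure RX-value is an item or a finite set of items (an item $i$ is not identified with $\{i\}$). **Types and kinds.** Pure RX-types: $\tau::=\mathbf{coll}(\iota)\mid\iota\mid\tau\cup\tau$; $\iota::=\mathbf{atom}\mid\nu\mid\iota\cup\iota$; $\nu::=\mathbf{data}\mid\mathbf{elem}(\nu_1\cup\dots\cup\nu_k)$ with $k\ge0$. Denotations: $\mathbf{atom}$ is $\mathcal A$; $\mathbf{data}$ is the set of all data nodes; $\mathbf{elem}(\nu_1\cup\dots\cup\nu_k)$ is the set of all $\langle a:N\rangle$ with $N$ a finite subset of the union of the denotations of $\nu_1,\dots,\nu_k$; $\cup$ is union; $\mathbf{coll}(\iota)$ is the set of all finite subsets of the denotation of $\iota$. RX-kinds: $\kappa::=\mathbf{atom}\mid\mathbf{data}\mid\mathbf{elem}\mid\kappa\cup\kappa$,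 denoting all atoms, all data nodes, all element nodes, and unions. Types and kinds are identified with their denotations. **Expressions.** Pure PERX expressions are generated by $$e::=x\mid text\{e\}\mid elem\{e\}\{e\}\mid data(e)\mid name(e)\mid children(e)\mid()\mid(e)\mid e,e\mid for\ x:\kappa\ in\ e\ return\ e\mid if\ e\ eq\ e\ then\ e\ else\ e,$$ with $x$ ranging over an infinite set of variables; in ''$for\ x:\kappa\ in\ e_1\ return\ e_2$'' the variable $x$ is bound in $e_2$. $FV(e)$ is the set of free variables. **Semantics.** An environment $\sigma$ on $e$ maps each $x\in FV(e)$ to a pure RX-value; $x:v,\sigma$ is $\sigma$ updated to send $x$ to $v$. The partial semantics is: $x(\sigma)=\sigma(x)$; $text\{e\}(\sigma)=\langle a\rangle$ if $e(\sigma)=a\in\mathcal A$, undefined otherwise; $elem\{e_1\}\{e_2\}(\sigma)=\langle a:N\rangle$ if $e_1(\sigma)=a\in\mathcal A$ and $w=e_2(\sigma)$ is a set, where $N=\{\langle b\rangle\mid b\in w\text{ an atom}\}\cup\{i\in w\mid i\text{ a node}\}$, undefined otherwise; $data(e)(\sigma)=\{a\mid a\in v\text{ an atom}\}\cup\{a\mid\langle a\rangle\in v\}$ where $v=e(\sigma)$; $name(e)(\sigma)=a$ if $e(\sigma)=\langle a:N\rangle$, undefined otherwise; $children(e)(\sigma)$ is undefined if $v=e(\sigma)$ contains an atom, and otherwise is $\bigcup\{N\mid\langle a:N\rangle\in v\}$; $()(\sigma)=\emptyset$; $(e)(\sigma)=\{e(\sigma)\}$ if $e(\sigma)$ is an item,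 undefined otherwise; $(e_1,e_2)(\sigma)=e_1(\sigma)\cup e_2(\sigma)$; $(for\ x:\kappa\ in\ e_1\ return\ e_2)(\sigma)=\bigcup\{e_2(x:i,\sigma)\mid i\in e_1(\sigma)\cap\kappa\}$; $(if\ e_1\ eq\ e_2\ then\ e_3\ else\ e_4)(\sigma)$ is $e_3(\sigma)$ if $e_1(\sigma)=e_2(\sigma)\in\mathcal A$, is $e_4(\sigma)$ if $e_1(\sigma)\ne e_2(\sigma)$ are both in $\mathcal A$, and is undefined otherwise. Convention: set operations (membership, union, intersection, iteration) applied to a non-set are undefined; in particular $data$, $children$, comma, the range $e_1$ and the results of $e_2$ in a for expression require sets. An expression is undefined if any value referred to in its clause is undefined (branches not taken are not evaluated). **Type assignments.** A type assignment $\Gamma$ on $e$ maps each $x\in FV(e)$ to a pure RX-type; $\sigma\in\Gamma$ means that $\sigma$ and $\Gamma$ have the same domain and $\sigma(x)\in\Gamma(x)$ for all $x$. *)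

(* Defs.v *)
From HB Require Import structures.
From mathcomp Require Import all_boot.
From mathcomp Require Import finmap.
From mathcomp Require Import boolp classical_sets cardinality.

Set Implicit Arguments.
Unset Strict Implicit.
Unset Printing Implicit Defensive.

Local Open Scope fset_scope.

(* Model of computation: the weak call-by-value lambda-calculus of Plotkin and
   Forster-Smolka, in de Bruijn notation.  Abstractions are the values, and
   nothing is reduced under a binder.  Substitution does not lift its argument,
   which is correct because all programs and data below are closed. *)
Inductive lterm : Type :=
| Lvar of nat
| Lapp of lterm & lterm
| Llam of lterm.

Fixpoint lclosed (k : nat) (t : lterm) : bool :=
  match t with
  | Lvar n => n < k
  | Lapp t1 t2 => lclosed k t1 && lclosed k t2
  | Llam t1 => lclosed k.+1 t1
  end.

Fixpoint lsubst (t : lterm) (k : nat) (u : lterm) : lterm :=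
  match t with
  | Lvar n => if n == k then u else Lvar n
  | Lapp t1 t2 => Lapp (lsubst t1 k u) (lsubst t2 k u)
  | Llam t1 => Llam (lsubst t1 k.+1 u)
  end.

Inductive leval : lterm -> lterm -> Prop :=
| leval_lam t : leval (Llam t) (Llam t)
| leval_app t1 t2 b v w :
    leval t1 (Llam b) -> leval t2 v -> leval (lsubst b 0 v) w ->
    leval (Lapp t1 t2) w.

Definition lhalts (t : lterm) : Prop := exists v, leval t v.

(* Inputs are presented to programs as binary trees, under Scott encoding:
   nil is \x y. x and cons a b is \x y. y a b. *)
Inductive dtree : Type := Dnil | Dcons of dtree & dtree.

Fixpoint lenc (d : dtree) : lterm :=
  match d with
  | Dnil => Llam (Llam (Lvar 1))
  | Dcons a b => Llam (Llam (Lapp (Lapp (Lvar 0) (lenc a)) (lenc b)))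
  end.

Definition lbool (b : bool) : lterm :=
  if b then Llam (Llam (Lvar 1)) else Llam (Llam (Lvar 0)).

(* Some program answers, on every instance satisfying the promise [D], whether
   [P] holds of it; [code] is the presentation of instances as trees. *)
Definition decidable_on (X : Type) (code : X -> dtree) (D P : X -> Prop) : Prop :=
  exists2 t : lterm, lclosed 0 t &
    forall x : X, D x ->
      exists2 b : bool, leval (Lapp t (lenc (code x))) (lbool b) & (b <-> P x).

Fixpoint dnat (n : nat) : dtree :=
  if n is n'.+1 then Dcons Dnil (dnat n') else Dnil.

Definition dseq (s : seq dtree) : dtree := foldr Dcons Dnil s.

Definition dnode (tag : nat) (s : seq dtree) : dtree := Dcons (dnat tag) (dseq s).

Definition recursively_enumerable (S : set nat) : Prop :=
  exists2 t : lterm, lclosed 0 t &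
    forall n : nat, S n <-> lhalts (Lapp t (lenc (dnat n))).

(* Nodes are hereditarily finite sets decorated with atoms.  They are carved out
   of the trees [raw], in which a set of children is a sequence, by requiring
   every sequence of children to be the canonical (in particular duplicate-free)
   enumeration of its elements used by {fset _}.  The lemmas from [data_nodeK]
   to [node_ind] characterise the resulting type as the inductive type generated
   by <a> ([data_node]) and <a : N> ([elem_node]). *)
Section Nodes.

Variable A : choiceType.

Unset Elimination Schemes.
Inductive raw : Type := RData of A | RElem of A & seq raw.
Set Elimination Schemes.

Lemma raw_ind (P : raw -> Prop) :
  (forall a, P (RData a)) ->
  (forall a s, foldr (fun r => and (P r)) True s -> P (RElem a s)) ->
  forall r, P r.
Proof.
move=> Hd He; fix loop 1; case=> [a|a s]; first exact: Hd.
apply: He; elim: s => [|r s IHs]; first exact: I.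
by split; [exact: loop | exact: IHs].
Qed.

Fixpoint raw_code (r : raw) : GenTree.tree A :=
  match r with
  | RData a => GenTree.Leaf a
  | RElem a s => GenTree.Node 0 (GenTree.Leaf a :: map raw_code s)
  end.

Fixpoint raw_decode (t : GenTree.tree A) : option raw :=
  match t with
  | GenTree.Leaf a => Some (RData a)
  | GenTree.Node _ (GenTree.Leaf a :: s) => Some (RElem a (pmap raw_decode s))
  | _ => None
  end.

Lemma raw_codeK : pcancel raw_code raw_decode.
Proof.
elim=> //= a s IHs; congr (Some (RElem a _)).
by elim: s IHs => //= r s IHs [-> /IHs ->].
Qed.

HB.instance Definition _ := Choice.copy raw (pcan_type raw_codeK).

Fixpoint raw_canonical (r : raw) : bool :=
  if r is RElem _ s then canonical_keys s && all raw_canonical s else true.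

Record node : Type := Node { node_raw : raw; _ : raw_canonical node_raw }.

HB.instance Definition _ := [isSub for node_raw].
HB.instance Definition _ := [Choice of node by <:].

Definition data_node (a : A) : node := @Node (RData a) isT.

Lemma elem_node_subproof (a : A) (N : {fset node}) :
  raw_canonical (RElem a (sort_keys (map val N))).
Proof.
rewrite /= canonical_sort_keys; apply/allP => r /mem_sort_keys_intro.
by case/mapP=> n _ ->; exact: valP n.
Qed.

Definition elem_node (a : A) (N : {fset node}) : node :=
  Node (elem_node_subproof a N).

(* The inverse of [data_node] and [elem_node]. *)
Definition node_view (n : node) : A + A * {fset node} :=
  match val n with
  | RData a => inl a
  | RElem a s => inr (a, [fset m in (pmap insub s : seq node)])
  end.

Lemma data_nodeK (a : A) : node_view (data_node a) = inl a.
Proof. by []. Qed.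

Lemma elem_nodeK (a : A) (N : {fset node}) :
  node_view (elem_node a N) = inr (a, N).
Proof.
rewrite /node_view /=; congr (inr (a, _)); apply/fsetP => m.
rewrite !inE /= mem_pmap_sub /=; apply/idP/idP.
  by move/mem_sort_keys_intro; rewrite (mem_map val_inj).
by move=> mN; apply: mem_sort_keys; rewrite (mem_map val_inj).
Qed.

Lemma node_viewK (n : node) :
  match node_view n with
  | inl a => n = data_node a
  | inr (a, N) => n = elem_node a N
  end.
Proof.
case: n => -[a|a s] rP; apply: val_inj => //=.
congr RElem; case/andP: (rP) => /eqP cs /allP sP; rewrite -{1}cs.
apply/eq_sort_keys => r; apply/idP/mapP => [rs|[m]].
  by exists (Sub r (sP r rs)) => //; rewrite !inE /= mem_pmap_sub.
by rewrite !inE /= mem_pmap_sub => ms ->.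
Qed.

Lemma node_ind (P : node -> Prop) :
  (forall a, P (data_node a)) ->
  (forall a N, (forall m, m \in N -> P m) -> P (elem_node a N)) ->
  forall n, P n.
Proof.
move=> Hd He n; case: n => r; elim: r => [a|a s IHs] rP.
  by have -> : Node rP = data_node a by exact: val_inj.
have := node_viewK (Node rP); rewrite /node_view /= => ->.
apply: He => m; rewrite !inE /= mem_pmap_sub.
case: m => r' r'P /=; elim: s IHs {rP} => //= r s IHs [Pr Ps].
rewrite inE => /predU1P[rr'|]; last exact: IHs.
by subst r'; exact: Pr.
Qed.

Inductive item : Type := IAtom of A | INode of node.

Definition item_code (i : item) : A + node :=
  match i with IAtom a => inl a | INode n => inr n end.

Definition item_decode (u : A + node) : item :=
  match u with inl a => IAtom a | inr n => INode n end.

Lemma item_codeK : cancel item_code item_decode.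
Proof. by case. Qed.

HB.instance Definition _ := Choice.copy item (can_type item_codeK).

Inductive value : Type := VItem of item | VSet of {fset item}.

End Nodes.

Arguments IAtom {A}.
Arguments INode {A}.
Arguments VItem {A}.
Arguments VSet {A}.

Inductive ntype : Type := Tdata | Telem of seq ntype.

Inductive itype : Type := Tatom | Tnode of ntype | Tiunion of itype & itype.

Inductive rxtype : Type :=
| Tcoll of itype
| Titem of itype
| Tunion of rxtype & rxtype.

Inductive kind : Type := Katom | Kdata | Kelem | Kunion of kind & kind.

Inductive expr : Type :=
| Evar of nat
| Etext of expr
| Eelem of expr & expr
| Edata of expr
| Ename of expr
| Echildren of expr
| Eempty                                    (* () *)
| Esingleton of expr                        (* (e) *)
| Ecomma of expr & expr                     (* e1, e2 *)
| Efor of nat & kind & expr & expr          (* for x:k in e1 return e2 *)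
| Eif of expr & expr & expr & expr.         (* if e1 eq e2 then e3 else e4 *)

Fixpoint FV (e : expr) : {fset nat} :=
  match e with
  | Evar x => [fset x]
  | Eempty => fset0
  | Etext e1 | Edata e1 | Ename e1 | Echildren e1 | Esingleton e1 => FV e1
  | Eelem e1 e2 | Ecomma e1 e2 => FV e1 `|` FV e2
  | Efor x _ e1 e2 => FV e1 `|` (FV e2 `\ x)
  | Eif e1 e2 e3 e4 => FV e1 `|` FV e2 `|` FV e3 `|` FV e4
  end.

Section Semantics.

Variable A : choiceType.

Fixpoint in_ntype (t : ntype) (n : node A) : bool :=
  match t, node_view n with
  | Tdata, inl _ => true
  | Telem ts, inr (_, N) => all (fun m => has (fun t' => in_ntype t' m) ts) N
  | _, _ => false
  end.

Fixpoint in_itype (t : itype) (i : item A) : bool :=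
  match t with
  | Tatom => if i is IAtom _ then true else false
  | Tnode t1 => if i is INode n then in_ntype t1 n else false
  | Tiunion t1 t2 => in_itype t1 i || in_itype t2 i
  end.

Fixpoint in_type (t : rxtype) (v : value A) : bool :=
  match t with
  | Tcoll t1 => if v is VSet w then all (in_itype t1) w else false
  | Titem t1 => if v is VItem i then in_itype t1 i else false
  | Tunion t1 t2 => in_type t1 v || in_type t2 v
  end.

Fixpoint in_kind (k : kind) (i : item A) : bool :=
  match k with
  | Katom => if i is IAtom _ then true else false
  | Kdata => if i is INode n then (if node_view n is inl _ then true else false)
             else false
  | Kelem => if i is INode n then (if node_view n is inr _ then true else false)
             else false
  | Kunion k1 k2 => in_kind k1 i || in_kind k2 i
  end.

(* { <b> | b an atom of w } together with the nodes of w *)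
Definition content (w : {fset item A}) : {fset node A} :=
  [fset (match i with IAtom b => data_node b | INode n => n end) | i in w].

(* the atoms of w together with { a | <a> in w } *)
Definition atomize (w : {fset item A}) : {fset item A} :=
  [fset i in pmap (fun i => match i with
                            | IAtom a => Some (IAtom a)
                            | INode n => if node_view n is inl a
                                         then Some (IAtom a) else None
                            end) w].

Definition children_of (i : item A) : {fset item A} :=
  if i is INode n then
    (if node_view n is inr (_, N) then [fset INode m | m in N] else fset0)
  else fset0.

(* The union of a family of results, defined if all of them are defined and
   are sets. *)
Definition union_results (s : seq (option (value A))) : option (value A) :=
  omap VSet
    (foldr (fun r acc => if (r, acc) is (Some (VSet w), Some u)
                         then Some (w `|` u) else None) (Some fset0) s).

(* Finite maps: an environment has its set of variables as domain. *)
Definition env : Type := {fmap nat -> value A}.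

Fixpoint eval (e : expr) (s : env) : option (value A) :=
  match e with
  | Evar x => s.[? x]
  | Etext e1 =>
      if eval e1 s is Some (VItem (IAtom a))
      then Some (VItem (INode (data_node a))) else None
  | Eelem e1 e2 =>
      if (eval e1 s, eval e2 s) is (Some (VItem (IAtom a)), Some (VSet w))
      then Some (VItem (INode (elem_node a (content w)))) else None
  | Edata e1 =>
      if eval e1 s is Some (VSet w) then Some (VSet (atomize w)) else None
  | Ename e1 =>
      if eval e1 s is Some (VItem (INode n)) then
        if node_view n is inr (a, _) then Some (VItem (IAtom a)) else None
      else None
  | Echildren e1 =>
      if eval e1 s is Some (VSet w) then
        if has (in_kind Katom) w then None
        else Some (VSet (\bigcup_(i <- w) children_of i))
      else None
  | Eempty => Some (VSet fset0)
  | Esingleton e1 =>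
      if eval e1 s is Some (VItem i) then Some (VSet [fset i]) else None
  | Ecomma e1 e2 =>
      if (eval e1 s, eval e2 s) is (Some (VSet w1), Some (VSet w2))
      then Some (VSet (w1 `|` w2)) else None
  | Efor x k e1 e2 =>
      if eval e1 s is Some (VSet w) then
        union_results
          [seq eval e2 s.[x <- VItem i] | i <- enum_fset w & in_kind k i]
      else None
  | Eif e1 e2 e3 e4 =>
      if (eval e1 s, eval e2 s)
        is (Some (VItem (IAtom a)), Some (VItem (IAtom b)))
      then if a == b then eval e3 s else eval e4 s
      else None
  end%fmap.

Definition tassign : Type := {fmap nat -> rxtype}.

Definition env_in (s : env) (G : tassign) : Prop :=
  domf s = domf G /\
  forall x v t, s.[? x]%fmap = Some v -> G.[? x]%fmap = Some t -> in_type t v.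

Definition well_defined (e : expr) (G : tassign) : Prop :=
  forall s : env, env_in s G -> exists v, eval e s = Some v.

Definition well_typed (e : expr) (G : tassign) (t : rxtype) : Prop :=
  forall s : env, env_in s G -> exists2 v, eval e s = Some v & in_type t v.

End Semantics.

(* A type assignment on e has domain exactly FV(e). *)
Definition tassign_on (e : expr) (G : tassign) : Prop := domf G = FV e.

(* Presentation of instances as trees: each constructor becomes a tag followed
   by the list of its arguments, and a type assignment is the list of its
   bindings in increasing order of variables. *)
Fixpoint dntype (t : ntype) : dtree :=
  match t with
  | Tdata => dnode 0 [::]
  | Telem ts => dnode 1 (map dntype ts)
  end.

Fixpoint ditype (t : itype) : dtree :=
  match t with
  | Tatom => dnode 0 [::]
  | Tnode t1 => dnode 1 [:: dntype t1]
  | Tiunion t1 t2 => dnode 2 [:: ditype t1; ditype t2]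
  end.

Fixpoint dtype (t : rxtype) : dtree :=
  match t with
  | Tcoll t1 => dnode 0 [:: ditype t1]
  | Titem t1 => dnode 1 [:: ditype t1]
  | Tunion t1 t2 => dnode 2 [:: dtype t1; dtype t2]
  end.

Fixpoint dkind (k : kind) : dtree :=
  match k with
  | Katom => dnode 0 [::]
  | Kdata => dnode 1 [::]
  | Kelem => dnode 2 [::]
  | Kunion k1 k2 => dnode 3 [:: dkind k1; dkind k2]
  end.

Fixpoint dexpr (e : expr) : dtree :=
  match e with
  | Evar x => dnode 0 [:: dnat x]
  | Etext e1 => dnode 1 [:: dexpr e1]
  | Eelem e1 e2 => dnode 2 [:: dexpr e1; dexpr e2]
  | Edata e1 => dnode 3 [:: dexpr e1]
  | Ename e1 => dnode 4 [:: dexpr e1]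
  | Echildren e1 => dnode 5 [:: dexpr e1]
  | Eempty => dnode 6 [::]
  | Esingleton e1 => dnode 7 [:: dexpr e1]
  | Ecomma e1 e2 => dnode 8 [:: dexpr e1; dexpr e2]
  | Efor x k e1 e2 => dnode 9 [:: dnat x; dkind k; dexpr e1; dexpr e2]
  | Eif e1 e2 e3 e4 => dnode 10 [:: dexpr e1; dexpr e2; dexpr e3; dexpr e4]
  end.

Definition dtassign (G : tassign) : dtree :=
  dseq (pmap (fun x => omap (fun t => Dcons (dnat x) (dtype t)) G.[? x]%fmap)
             (sort leq (domf G))).

Definition dinstance1 (p : expr * tassign) : dtree :=
  dseq [:: dexpr p.1; dtassign p.2].

Definition dinstance2 (p : expr * tassign * rxtype) : dtree :=
  dseq [:: dexpr p.1.1; dtassign p.1.2; dtype p.2].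

(* Main.v *)
Require Import Defs.
From HB Require Import structures.
From mathcomp Require Import all_boot finmap.
From mathcomp Require Import boolp classical_sets cardinality.
From mathcomp Require Import zify.

(* Order values by the Hoare order: atoms are rigid, and a set or element node
   is below another if each of its members is below some member of the other.
   With undefinedness as top element every construct is monotone and finitary:
   a result is forced above a given finite value by a lower approximation of
   the environment whose size is computable from the expression.  Types are
   closed downwards, and failure of membership in a type is witnessed by a
   small lower approximation.  Hence a counterexample to well-definedness or
   well-typedness yields one of computable size; since atoms are only compared
   for equality, it can be renamed to use a bounded set of atoms, and an
   exhaustive search decides the problem.

   The search is programmed in Gallina over types related to closed lambda
   terms by a logical relation, and the relation is closed under application,
   abstraction and recursion over trees and lists. *)

Set Implicit Arguments.
Unset Strict Implicit.
Unset Printing Implicit Defensive.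

(** * Realizability in the lambda-calculus *)

(** Evaluation is monotone because the language sees sets only positively: equality tests concern
    atoms, and no construct detects that a member is absent. Errors are positive as well. They come
    from a root of the wrong kind, which the order keeps fixed, or from a member that is present: an
    atom in the argument of [children], or an element at which a loop body fails. Enlarging an input
    can therefore enlarge the result or make it undefined, never repair it. This is why
    undefinedness must be the top element rather than the bottom, and why one looks for small inputs
    that already fail.

    Both problems are treated at once through [accept], whose type argument is optional. The search
    runs over trees labelled by natural numbers. The bijection between labels and the actual atoms
    occurs only in the proof that the search is correct, so the program never computes with it. *)

Definition lval (t : lterm) : bool :=
  lclosed 0 t && (if t is Llam _ then true else false).

Lemma lclosed_leq (t : lterm) (k l : nat) : lclosed k t -> k <= l -> lclosed l t.
Proof.
elim: t k l => [n|t1 IH1 t2 IH2|t IH] k l /=.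
- by move=> nk kl; exact: leq_trans kl.
- by case/andP=> c1 c2 kl; rewrite (IH1 k l) ?(IH2 k l).
- by move=> c kl; apply: IH c _.
Qed.

Lemma lsubst_closed (t u : lterm) (j k : nat) :
  lclosed j t -> j <= k -> lsubst t k u = t.
Proof.
elim: t j k => [n|t1 IH1 t2 IH2|t IH] j k /=.
- by move=> nj jk; rewrite ltn_eqF // (leq_trans nj).
- by case/andP=> c1 c2 jk; rewrite (IH1 j) ?(IH2 j).
- by move=> c jk; rewrite (IH j.+1).
Qed.

Lemma lval_closed (t : lterm) (k : nat) : lval t -> lclosed k t.
Proof. by case/andP=> c _; exact: lclosed_leq c _. Qed.

Lemma lval_subst (t u : lterm) (k : nat) : lval t -> lsubst t k u = t.
Proof. by case/andP=> c _; exact: lsubst_closed c _. Qed.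

Lemma leval_val (t : lterm) : lval t -> leval t t.
Proof. by case: t => [n|t1 t2|t] /andP[] // _ _; exact: leval_lam. Qed.

Lemma leval_beta (b v w : lterm) :
  lval v -> leval (lsubst b 0 v) w -> leval (Lapp (Llam b) v) w.
Proof. by move=> vv ev; apply: leval_app (leval_lam b) (leval_val vv) ev. Qed.

Lemma leval_fun_val (t t' : lterm) : leval t t' -> exists b, t' = Llam b.
Proof. by elim=> [b|t1 t2 b v w _ _ _ _ _ IH]; [exists b | exact: IH]. Qed.

(** Together with [leval_appr], this turns big-step evaluation into a stepwise calculation: either
    side of an application may be replaced by its value before going on. *)
Lemma leval_appl (t t' u w : lterm) :
  leval t t' -> leval (Lapp t' u) w -> leval (Lapp t u) w.
Proof.
move=> tt' ev; inversion ev as [|a1 a2 b v w' e1 e2 e3]; subst.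
have [c ec] := leval_fun_val tt'; subst t'; inversion e1; subst.
exact: leval_app tt' e2 e3.
Qed.

Lemma leval_idem (v w : lterm) : lval v -> leval v w -> w = v.
Proof. by case: v => // [? ?|b] /andP[] // _ _ ev; inversion ev. Qed.

Lemma leval_appr (t u u' w : lterm) :
  lval u' -> leval u u' -> leval (Lapp t u') w -> leval (Lapp t u) w.
Proof.
move=> vu uu' ev; inversion ev as [|a1 a2 b v w' e1 e2 e3]; subst.
by rewrite (leval_idem vu e2) in e3; apply: leval_app e1 uu' e3.
Qed.

(** Representing terms must be closed abstractions: substitution does not lift its argument, and a
    representative has to evaluate to itself. *)
Class enc (A : Type) := Enc {
  rel : A -> lterm -> Prop;
  rel_lval : forall a t, rel a t -> lval t }.

Definition Real {A : Type} {EA : enc A} (a : A) : Prop := exists t, rel a t.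

Local Obligation Tactic := idtac.

(** The application is required to terminate on every represented argument, so eager evaluation of
    an argument can never diverge. *)
Program Instance enc_fun (A B : Type) (EA : enc A) (EB : enc B) : enc (A -> B) :=
  {| rel f t := lval t /\
       forall a u, rel a u -> exists2 v, leval (Lapp t u) v & rel (f a) v |}.
Next Obligation. by move=> A B EA EB f t []. Qed.

Program Instance enc_prod (A B : Type) (EA : enc A) (EB : enc B) : enc (A * B) :=
  {| rel p t := exists u v,
       [/\ t = Llam (Lapp (Lapp (Lvar 0) u) v), rel p.1 u & rel p.2 v] |}.
Next Obligation.
move=> A B EA EB p t [u [v [-> ru rv]]].
have vu := rel_lval ru; have vv := rel_lval rv.
by rewrite /lval /= !lval_closed.
Qed.

(** The shape of [lenc] with arbitrary representatives as left subterms. Thus a list of trees is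
    represented by the same term as the tree [dseq] makes of it, and conversion is free. *)
Fixpoint rel_seq (A : Type) (EA : enc A) (s : seq A) (t : lterm) : Prop :=
  match s with
  | [::] => t = lenc Dnil
  | x :: s' => exists u v,
      [/\ t = Llam (Llam (Lapp (Lapp (Lvar 0) u) v)), rel x u & rel_seq EA s' v]
  end.

Program Instance enc_seq (A : Type) (EA : enc A) : enc (seq A) :=
  {| rel := rel_seq EA |}.
Next Obligation.
move=> A EA [|x s] t /=; first by move=> ->.
elim: s x t => [|y s IH] x t [u [v [-> ru rs]]] /=.
  have vu := rel_lval ru.
  by move: rs => /= ->; rewrite /lval /= !lval_closed.
have vu := rel_lval ru; have vv := IH _ _ rs.
by rewrite /lval /= !lval_closed.
Qed.

Program Instance enc_bool : enc bool := {| rel b t := t = lbool b |}.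
Next Obligation. by move=> [] t ->. Qed.

Lemma lval_lenc (d : dtree) : lval (lenc d).
Proof. by elim: d => //= a IHa b IHb; rewrite /lval /= !lval_closed. Qed.

Program Instance enc_dtree : enc dtree := {| rel d t := t = lenc d |}.
Next Obligation. by move=> d t ->; exact: lval_lenc. Qed.

Program Instance enc_nat : enc nat := {| rel n t := t = lenc (dnat n) |}.
Next Obligation. by move=> d t ->; exact: lval_lenc. Qed.

Ltac lsimp := rewrite /= ?lval_subst //.
Ltac lbeta := apply: leval_beta => //; lsimp.

Lemma real_id (A : Type) (EA : enc A) : Real (fun a : A => a).
Proof.
exists (Llam (Lvar 0)); split => // a u ru; exists u => //.
by have vu := rel_lval ru; lbeta; exact: leval_val.
Qed.

(** * Realizers of the basic combinators and recursors *)

Section Combinators.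

Variables (A B C : Type) (EA : enc A) (EB : enc B) (EC : enc C).

Lemma real_app (f : A -> B) (a : A) : Real f -> Real a -> Real (f a).
Proof. by move=> [t [_ Ht]] [u /Ht [v _ rv]]; exists v. Qed.

Lemma real_const (a : A) : Real a -> Real (fun _ : C => a).
Proof.
move=> [t rt]; have vt := rel_lval rt; exists (Llam t); split=> [|c u ru].
  by rewrite /lval /= lval_closed.
have vu := rel_lval ru; exists t => //.
by lbeta; exact: leval_val.
Qed.

Lemma real_ap (f : C -> A -> B) (x : C -> A) :
  Real f -> Real x -> Real (fun c => f c (x c)).
Proof.
move=> [t [vt Ht]] [s [vs Hs]].
exists (Llam (Lapp (Lapp t (Lvar 0)) (Lapp s (Lvar 0)))); split=> [|c u ru].
  by rewrite /lval /= !lval_closed.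
have vu := rel_lval ru.
have [t' et [vt' Ht']] := Ht _ _ ru; have [s' es rs'] := Hs _ _ ru.
have [v ev rv] := Ht' _ _ rs'; exists v => //; lbeta.
exact: leval_appl et (leval_appr (rel_lval rs') es ev).
Qed.

Lemma real_lam (g : C * A -> B) : Real g -> Real (fun c a => g (c, a)).
Proof.
move=> [t [vt Ht]].
exists (Llam (Llam (Lapp t (Llam (Lapp (Lapp (Lvar 0) (Lvar 2)) (Lvar 1)))))).
split=> [|c u ru]; first by rewrite /lval /= !lval_closed.
have vu := rel_lval ru.
eexists; first by lbeta; exact: leval_lam.
split=> [|a w rw]; first by rewrite /lval /= !lval_closed.
have vw := rel_lval rw.
have rp : rel (c, a) (Llam (Lapp (Lapp (Lvar 0) u) w)) by exists u, w.
by have [v ev rv] := Ht _ _ rp; exists v => //; lbeta.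
Qed.

Lemma real_fst : Real (@fst A B).
Proof.
exists (Llam (Lapp (Lvar 0) (Llam (Llam (Lvar 1))))); split=> // p t.
case=> u [v [-> ru rv]]; have vu := rel_lval ru; have vv := rel_lval rv.
exists u => //; apply: leval_beta; first by rewrite /lval /= !lval_closed.
lsimp; lbeta.
apply: leval_appl; first by lbeta; exact: leval_lam.
by lbeta; exact: leval_val.
Qed.

Lemma real_snd : Real (@snd A B).
Proof.
exists (Llam (Lapp (Lvar 0) (Llam (Llam (Lvar 0))))); split=> // p t.
case=> u [v [-> ru rv]]; have vu := rel_lval ru; have vv := rel_lval rv.
exists v => //; apply: leval_beta; first by rewrite /lval /= !lval_closed.
lsimp; lbeta.
apply: leval_appl; first by lbeta; exact: leval_lam.
by lbeta; exact: leval_val.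
Qed.

Lemma real_nil : Real (@nil A).
Proof. by exists (lenc Dnil). Qed.

Lemma real_cons : Real (@cons A).
Proof.
exists (Llam (Llam (Llam (Llam (Lapp (Lapp (Lvar 0) (Lvar 3)) (Lvar 2)))))).
split=> // a u ru; have vu := rel_lval ru.
eexists; first by lbeta; exact: leval_lam.
split=> [|s v rv]; first by rewrite /lval /= !lval_closed.
have vv := rel_lval rv.
eexists; first by lbeta; exact: leval_lam.
by exists u, v.
Qed.

(* w w s unfolds the recursion: the Scott list s is applied to z and to
   \x r. f x (w w r). *)
Let foldW (f z : lterm) : lterm :=
  Llam (Llam (Lapp (Lapp (Lvar 0) z)
    (Llam (Llam (Lapp (Lapp f (Lvar 1))
                      (Lapp (Lapp (Lvar 3) (Lvar 3)) (Lvar 0))))))).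

Lemma real_foldr : Real (@foldr A B).
Proof.
exists (Llam (Llam (Llam (Lapp (Lapp (foldW (Lvar 6) (Lvar 3))
  (foldW (Lvar 6) (Lvar 3))) (Lvar 0))))).
split=> // f tf rf; have vf := rel_lval rf.
eexists; first by lbeta; exact: leval_lam.
split=> [|z tz rz]; first by rewrite /lval /= !lval_closed.
have vz := rel_lval rz.
eexists; first by lbeta; exact: leval_lam.
split=> [|s ts rs]; first by rewrite /lval /= !lval_closed.
pose W := foldW tf tz.
have vW : lval W by rewrite /lval /= !lval_closed.
suff [v ev rv] : exists2 v, leval (Lapp (Lapp W W) ts) v & @rel B EB (foldr f z s) v.
  exists v => //; have vts := rel_lval rs; lbeta.
elim: s ts rs => [|x s IH] ts rs; have vts := rel_lval rs.
  move: rs => /= rs; subst ts; exists tz => //.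
  apply: leval_appl; first by apply: leval_beta => //; lsimp; exact: leval_lam.
  lbeta; apply: leval_appl; first by lbeta; exact: leval_lam.
  apply: leval_beta; first by rewrite /lval /= !lval_closed.
  by lsimp; exact: leval_val.
case: rs => u [v [ets ru rv]]; have vu := rel_lval ru.
have vv : lval v by exact: (@rel_lval _ (enc_seq EA) s).
have [r er rr] := IH _ rv; have vr := rel_lval rr.
case: rf => _ Hf; have [f' ef [vf' Hf']] := Hf _ _ ru.
have [w ew rw] := Hf' _ _ rr.
exists w => //.
apply: leval_appl; first by apply: leval_beta => //; lsimp; exact: leval_lam.
subst ts; apply: leval_beta => //; lsimp.
apply: leval_appl; first by lbeta; exact: leval_lam.
apply: leval_beta; first by rewrite /lval /= !lval_closed.
lsimp; apply: leval_appl; first by lbeta; exact: leval_lam.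
lbeta; apply: leval_appl ef _.
exact: leval_appr vr er ew.
Qed.

(** The step also receives the subtrees themselves, so that selectors and the predecessor are
    instances. *)
Fixpoint drec (z : B) (f : dtree -> dtree -> B -> B -> B) (d : dtree) : B :=
  if d is Dcons a b then f a b (drec z f a) (drec z f b) else z.

Let drecW (z f : lterm) : lterm :=
  Llam (Llam (Lapp (Lapp (Lvar 0) z)
    (Llam (Llam (Lapp (Lapp (Lapp (Lapp f (Lvar 1)) (Lvar 0))
                      (Lapp (Lapp (Lvar 3) (Lvar 3)) (Lvar 1)))
                      (Lapp (Lapp (Lvar 3) (Lvar 3)) (Lvar 0))))))).

Lemma real_drec : Real drec.
Proof.
exists (Llam (Llam (Llam (Lapp (Lapp (drecW (Lvar 4) (Lvar 5))
  (drecW (Lvar 4) (Lvar 5))) (Lvar 0))))).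
split=> // z tz rz; have vz := rel_lval rz.
eexists; first by lbeta; exact: leval_lam.
split=> [|f tf rf]; first by rewrite /lval /= !lval_closed.
have vf := rel_lval rf.
eexists; first by lbeta; exact: leval_lam.
split=> [|d ts rs]; first by rewrite /lval /= !lval_closed.
pose W := drecW tz tf.
have vW : lval W by rewrite /lval /= !lval_closed.
suff [v ev rv] : exists2 v, leval (Lapp (Lapp W W) ts) v & @rel B EB (drec z f d) v.
  exists v => //; have vts := rel_lval rs; lbeta.
move: rs => /= -> {ts}; elim: d => [|a IHa b IHb].
  exists tz => //.
  apply: leval_appl; first by apply: leval_beta => //; lsimp; exact: leval_lam.
  lbeta; apply: leval_appl; first by lbeta; exact: leval_lam.
  apply: leval_beta; first by rewrite /lval /= !lval_closed.
  by lsimp; exact: leval_val.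
have va := lval_lenc a; have vb := lval_lenc b.
have vab := lval_lenc (Dcons a b).
have [ra ea rra] := IHa; have [rb eb rrb] := IHb.
have vra := rel_lval rra; have vrb := rel_lval rrb.
case: rf => _ Hf; have [f1 e1 [_ Hf1]] := Hf a _ erefl.
have [f2 e2 [_ Hf2]] := Hf1 b _ erefl.
have [f3 e3 [_ Hf3]] := Hf2 _ _ rra.
have [w ew rw] := Hf3 _ _ rrb.
exists w => //.
apply: leval_appl; first by apply: leval_beta => //; lsimp; exact: leval_lam.
apply: leval_beta => //; lsimp.
apply: leval_appl; first by lbeta; exact: leval_lam.
apply: leval_beta; first by rewrite /lval /= !lval_closed.
lsimp; apply: leval_appl; first by lbeta; exact: leval_lam.
lbeta; apply: leval_appr vrb eb _.
apply: leval_appl ew; apply: leval_appr vra ea _.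
apply: leval_appl e3; exact: leval_appl e1 e2.
Qed.

(** Makes the conditional an application, which bracket abstraction can split. Both branches get
    evaluated, harmlessly, since realizers always terminate. *)
Definition ifb (b : bool) (x y : A) : A := if b then x else y.

Lemma real_ifb : Real ifb.
Proof.
exists (Llam (Lvar 0)); split=> // b _ ->.
exists (lbool b); first by case: b; lbeta; exact: leval_lam.
split; first by case: b.
move=> x u ru; have vu := rel_lval ru.
exists (Llam (if b then u else Lvar 0)).
  by case: b; lbeta; exact: leval_lam.
split; first by case: (b); rewrite /lval /= ?lval_closed.
move=> y w rw; have vw := rel_lval rw.
exists (if b then u else w); last by case: b.
by case: b; lbeta; exact: leval_val.
Qed.

End Combinators.

Lemma real_pair (A B : Type) (EA : enc A) (EB : enc B) : Real (@pair A B).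
Proof. exact: (real_lam (g := fun p => p) (real_id _)). Qed.

Lemma real_bool (b : bool) : Real b.
Proof. by exists (lbool b). Qed.

Lemma real_nat (n : nat) : Real n.
Proof. by exists (lenc (dnat n)). Qed.

Lemma real_dtree (d : dtree) : Real d.
Proof. by exists (lenc d). Qed.

(* Conversions between types whose encodings coincide are realized by the
   identity. *)
Lemma real_coerce (A B : Type) (EA : enc A) (EB : enc B) (f : A -> B) :
  (forall a t, rel a t -> rel (f a) t) -> Real f.
Proof.
move=> Hf; exists (Llam (Lvar 0)); split=> // a u ru; exists u; last exact: Hf.
by have vu := rel_lval ru; lbeta; exact: leval_val.
Qed.

Create HintDb real.
#[export] Hint Resolve real_id real_fst real_snd real_pair real_nil real_cons
  real_foldr real_drec real_ifb real_bool real_nat real_dtree : real.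

(* Bracket abstraction: the free variables of a body are kept in one argument,
   a left-nested tuple. *)
Ltac creal := cbv beta; first [ solve [trivial with real] |
  match goal with
  | |- @Real _ _ (fun c => c) => apply: real_id
  | |- @Real _ _ (fun c : ?C => ?k) =>
      let k' := constr:(k) in apply: (@real_const _ C _ _ k')
  | |- @Real _ _ (fun (c : ?C) (a : ?A) => @?g c a) =>
      apply: (@real_lam _ _ _ _ _ _ (fun p : C * A => g p.1 p.2))
  | |- @Real _ _ (?f ?x) => apply: (@real_app _ _ _ _ f x)
  | |- @Real _ _ ?F =>
      let C := lazymatch F with (fun c : ?C => _) => C end in
      let p := constr:(fun c : C => ltac:(
        let b := eval cbv beta in (F c) in
        lazymatch b with ?f ?x => exact (f, x) end)) in
      lazymatch p with fun c => (@?f c, @?x c) =>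
        apply: (@real_ap _ _ _ _ _ _ f x) end
  end; creal ].

(** * Realizers for arithmetic and list functions *)

Definition dlist (d : dtree) : seq dtree :=
  drec [::] (fun a _ _ r => a :: r) d.

Lemma dlistK : cancel dseq dlist.
Proof. by rewrite /dlist; elim=> //= a s ->. Qed.

Definition dton (d : dtree) : nat := drec 0 (fun _ _ _ r => r.+1) d.

Lemma dtonK : cancel dnat dton.
Proof. by rewrite /dton; elim=> //= n ->. Qed.

Lemma real_dlist : Real dlist.
Proof. by rewrite /dlist; creal. Qed.

Lemma real_dnat : Real dnat.
Proof. exact: real_coerce. Qed.

(** The list constructor is also a realizer here, a tree being represented as the list of left
    subtrees along its right spine. *)
Lemma real_Dcons : Real Dcons.
Proof.
have [t rt] := real_cons (A := dtree) _; exists t; case: rt => vt Ht.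
split=> // a u ru; have [v ev [vv Hv]] := Ht _ _ ru.
exists v => //; split=> // b w rw; have rs : rel (dlist b) w.
  move: rw => /= -> {w}; elim: b => //= b1 _ b2 IH.
  by exists (lenc b1), (lenc b2).
have [x ex [u' [v' [ex' eu ev']]]] := Hv _ _ rs; exists x => //=.
have -> : lenc a = u' by [].
suff -> : lenc b = v' by [].
move: ev'; elim: (b) v' {ex' ex} => //= b1 _ b2 IH v'.
by case=> u1 [v1 [-> -> /IH ->]].
Qed.

#[export] Hint Resolve real_dlist real_dnat real_Dcons : real.

Lemma real_succn : Real S.
Proof.
have [t rt] : Real (fun n => Dcons Dnil (dnat n)) by creal.
by exists t.
Qed.

#[export] Hint Resolve real_succn : real.

Lemma real_dton : Real dton.
Proof. by rewrite /dton; creal. Qed.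

Lemma real_predn : Real predn.
Proof.
suff -> : predn = fun n => drec 0 (fun _ b _ _ => dton b) (dnat n).
  by have rd := real_dton; creal.
by apply/funext => -[|n] //=; rewrite dtonK.
Qed.

Lemma real_iter (A : Type) (EA : enc A) : Real (fun n f (x : A) => iter n f x).
Proof.
suff -> : (fun n f (x : A) => iter n f x) =
          fun n f x => drec x (fun _ _ _ r => f r) (dnat n) by creal.
by apply/funext => n; apply/funext => f; apply/funext => x; elim: n => //= n ->.
Qed.

#[export] Hint Resolve real_dton real_predn real_iter : real.

Lemma real_addn : Real addn.
Proof.
suff -> : addn = fun m n => (fun n f (x : nat) => iter n f x) m S n by creal.
by apply/funext => m; apply/funext => n; rewrite iter_succn addnC.
Qed.

#[export] Hint Resolve real_addn : real.

Lemma real_muln : Real muln.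
Proof.
suff -> : muln = fun m n => (fun n f (x : nat) => iter n f x) m (addn n) 0.
  by creal.
by apply/funext => m; apply/funext => n; rewrite iter_addn_0 mulnC.
Qed.

Lemma real_subn : Real subn.
Proof.
suff -> : subn = fun m n => (fun n f (x : nat) => iter n f x) n predn m by creal.
by apply/funext => m; apply/funext => n; rewrite iter_predn.
Qed.

#[export] Hint Resolve real_muln real_subn : real.

Definition iszero (n : nat) : bool := n == 0.

Lemma real_iszero : Real iszero.
Proof.
suff -> : iszero = fun n => drec true (fun _ _ _ _ => false) (dnat n).
  by creal.
by apply/funext => -[].
Qed.

Lemma real_leq : Real leq.
Proof.
suff -> : leq = fun m n => iszero (m - n).
  by have r0 := real_iszero; creal.
by apply/funext => m; apply/funext.
Qed.

Lemma real_andb : Real andb.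
Proof.
suff -> : andb = fun b c => ifb b c false by creal.
by apply/funext => -[]; apply/funext.
Qed.

Lemma real_orb : Real orb.
Proof.
suff -> : orb = fun b c => ifb b true c by creal.
by apply/funext => -[]; apply/funext.
Qed.

Lemma real_negb : Real negb.
Proof.
suff -> : negb = fun b => ifb b false true by creal.
by apply/funext => -[].
Qed.

#[export] Hint Resolve real_leq real_andb real_orb real_negb : real.

Lemma real_eqn : Real eqn.
Proof.
suff -> : eqn = fun m n => andb (leq m n) (leq n m) by creal.
by apply/funext => m; apply/funext => n; rewrite eqnE eqn_leq.
Qed.

#[export] Hint Resolve real_eqn : real.

Section Lists.

Variables (A B : Type) (EA : enc A) (EB : enc B).

Lemma real_cat : Real (@cat A).
Proof.
suff -> : @cat A = fun s t => foldr cons t s by creal.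
by apply/funext => s; apply/funext => t; elim: s => //= x s ->.
Qed.

Lemma real_map : Real (@map A B).
Proof.
suff -> : @map A B = fun f s => foldr (fun x r => f x :: r) [::] s by creal.
by apply/funext => f; apply/funext => s; elim: s => //= x s ->.
Qed.

Lemma real_filter : Real (@filter A).
Proof.
suff -> : @filter A =
    fun f s => foldr (fun x r => ifb (f x) (x :: r) r) [::] s by creal.
by apply/funext => f; apply/funext => s; elim: s => //= x s ->.
Qed.

Lemma real_all : Real (@all A).
Proof.
suff -> : @all A = fun f s => foldr (fun x r => andb (f x) r) true s by creal.
by apply/funext => f; apply/funext => s; elim: s => //= x s ->.
Qed.

Lemma real_has : Real (@has A).
Proof.
suff -> : @has A = fun f s => foldr (fun x r => orb (f x) r) false s by creal.
by apply/funext => f; apply/funext => s; elim: s => //= x s ->.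
Qed.

Lemma real_nth : Real (@nth A).
Proof.
suff -> : @nth A = fun x0 s n =>
    foldr (fun x r n => ifb (eqn n 0) x (r (predn n))) (fun _ => x0) s n.
  by creal.
apply/funext => x0; apply/funext => s; apply/funext => n.
by elim: s n => [|x s IH] [|n] //=.
Qed.

End Lists.

#[export] Hint Resolve real_cat real_map real_filter real_all real_has
  real_nth : real.

Lemma real_flatten (A : Type) (EA : enc A) : Real (@flatten A).
Proof. by rewrite /flatten; creal. Qed.

Lemma real_iota : Real iota.
Proof.
suff -> : iota = fun m n =>
    (fun n f (x : nat -> seq nat) => iter n f x) n
      (fun r m => m :: r m.+1) (fun _ => [::]) m by creal.
apply/funext => m; apply/funext => n.
by elim: n m => //= n IH m; rewrite IH.
Qed.

Lemma real_sumn : Real sumn.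
Proof.
suff -> : sumn = fun s => foldr addn 0 s by creal.
by apply/funext; elim=> //= x s ->.
Qed.

#[export] Hint Resolve real_flatten real_iota real_sumn : real.

(* The value at a subtree pairs its meaning as a tagged node with its meaning as
   a list of such nodes. *)
Definition rfold (M : Type) (m0 : M) (F : nat -> seq (dtree * M) -> M)
    (d : dtree) : M :=
  (drec (m0, [::])
    (fun a _ ra rb => (F (dton a) rb.2, (a, ra.1) :: rb.2)) d).1.

Lemma rfold_dnode (M : Type) (m0 : M) F (n : nat) (s : seq dtree) :
  rfold m0 F (dnode n s) = F n [seq (d, rfold m0 F d) | d <- s].
Proof.
rewrite /rfold /= dtonK; congr (F n _).
by elim: s => //= d s ->.
Qed.

Lemma real_rfold (M : Type) (EM : enc M) : Real (@rfold M).
Proof. by rewrite /rfold; creal. Qed.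

#[export] Hint Resolve real_rfold : real.

(** * Small counterexamples *)

(* Values over the atoms [nat], with sets as unordered lists with repetitions.
   The tag is 0 for an atom, 1 for a data node, 2 for an element node, 3 for a
   set and 4 for the undefined result; the second component is the atom, and 0
   for computed sets and for the undefined result. *)
Unset Elimination Schemes.
Inductive cv : Type := Cv of nat & nat & seq cv.
Set Elimination Schemes.

Lemma cv_ind_foldr (P : cv -> Prop) :
  (forall g a s, foldr (fun r => and (P r)) True s -> P (Cv g a s)) ->
  forall t, P t.
Proof.
move=> H; fix loop 1; case=> g a s.
apply: H; elim: s => [|r s IHs]; first exact: I.
by split; [exact: loop | exact: IHs].
Qed.

Fixpoint cv_code (t : cv) : GenTree.tree nat :=
  let: Cv g a s := t in GenTree.Node g (GenTree.Leaf a :: map cv_code s).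

Fixpoint cv_decode (t : GenTree.tree nat) : option cv :=
  match t with
  | GenTree.Node g (GenTree.Leaf a :: s) => Some (Cv g a (pmap cv_decode s))
  | _ => None
  end.

Lemma cv_codeK : pcancel cv_code cv_decode.
Proof.
elim/cv_ind_foldr => //= g a s IHs; congr (Some (Cv g a _)).
by elim: s IHs => //= r s IHs [-> /IHs ->].
Qed.

HB.instance Definition _ := Choice.copy cv (pcan_type cv_codeK).

Lemma cv_ind (P : cv -> Prop) :
  (forall g a s, {in s, forall x, P x} -> P (Cv g a s)) -> forall t, P t.
Proof.
move=> H; elim/cv_ind_foldr => g a s Hs; apply: H => x.
elim: s Hs => //= y s IH [Py /IH Ps].
by rewrite inE => /predU1P[->|].
Qed.

Definition tag (t : cv) : nat := let: Cv g _ _ := t in g.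
Definition lab (t : cv) : nat := let: Cv _ a _ := t in a.
Definition kids (t : cv) : seq cv := let: Cv _ _ s := t in s.

(** * The preorder on trees, with undefinedness on top *)

Fixpoint le (x y : cv) : bool :=
  let: Cv g a s := x in
  [&& g == tag y, a == lab y & all (fun u => has (le u) (kids y)) s].

Lemma leE (x y : cv) :
  le x y = [&& tag x == tag y, lab x == lab y &
               all (fun u => has (le u) (kids y)) (kids x)].
Proof. by case: x. Qed.

Lemma leP (x y : cv) :
  reflect [/\ tag x = tag y, lab x = lab y &
           forall u, u \in kids x -> exists2 v, v \in kids y & le u v]
          (le x y).
Proof.
rewrite leE; apply: (iffP and3P).
  case=> /eqP -> /eqP -> /allP H; split=> // u /H /hasP[v vy uv].
  by exists v.
case=> -> -> H; split=> //; apply/allP => u /H [v vy uv]; apply/hasP.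
by exists v.
Qed.

Lemma le_refl (x : cv) : le x x.
Proof.
by elim: x => g a s IH; apply/leP; split=> // u us; exists u; rewrite ?IH.
Qed.

Lemma le_trans (y x z : cv) : le x y -> le y z -> le x z.
Proof.
elim: x y z => g a s IH y z /leP[e1 e2 xy] /leP[e3 e4 yz].
apply/leP; split; [by rewrite e1 | by rewrite e2 |] => u us.
have [v vy uv] := xy u us; have [w wz vw] := yz v vy.
by exists w => //; apply: IH uv vw.
Qed.

(** The least tree below [x]. It suffices, at size 1, wherever an operation inspects only the root
    of its argument. *)
Definition bot (x : cv) : cv := Cv (tag x) (lab x) [::].

Lemma le_bot (x : cv) : le (bot x) x. Proof. by apply/leP. Qed.

(* Undefined results are on top, which makes evaluation monotone. *)
Definition le_top (x y : cv) : bool := (tag y == 4) || le x y.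

Lemma le_top_refl (x : cv) : le_top x x. Proof. by rewrite /le_top le_refl orbT. Qed.

Lemma le_le_top (x y : cv) : le x y -> le_top x y.
Proof. by rewrite /le_top => ->; rewrite orbT. Qed.

Lemma le_top_trans (y x z : cv) : le_top x y -> le_top y z -> le_top x z.
Proof.
rewrite /le_top => xy; case: eqP => //= n4 yz; have [e _ _] := leP _ _ yz.
by move: xy; rewrite e; case: eqP => //= _ xy; apply: le_trans xy yz.
Qed.

Lemma le_top_tag (x y : cv) : le_top x y -> tag x = 4 -> tag y = 4.
Proof. by rewrite /le_top; case: eqP => //= _ /leP[-> _ _]. Qed.

Lemma le_top_le (x y : cv) : le_top x y -> tag y <> 4 -> le x y.
Proof. by rewrite /le_top; case: eqP. Qed.

Fixpoint csize (t : cv) : nat := let: Cv _ _ s := t in (sumn (map csize s)).+1.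

Lemma csizeE (t : cv) : csize t = (sumn (map csize (kids t))).+1.
Proof. by case: t. Qed.

Lemma csize_gt0 (t : cv) : 0 < csize t. Proof. by case: t. Qed.

Lemma csize_mem (x : cv) (s : seq cv) : x \in s -> csize x <= sumn (map csize s).
Proof.
elim: s => //= y s IH; rewrite inE => /predU1P[->|/IH]; first exact: leq_addr.
by move=> h; apply: leq_trans h _; exact: leq_addl.
Qed.

Lemma size_leq_csize (s : seq cv) : size s <= sumn (map csize s).
Proof. by elim: s => //= x s IH; have := csize_gt0 x; lia. Qed.

(** * Evaluation on trees *)

Definition Err : cv := Cv 4 0 [::].

Definition tonode (i : cv) : cv := if tag i == 0 then Cv 1 (lab i) [::] else i.

Definition op_text (v : cv) : cv :=
  if tag v == 0 then Cv 1 (lab v) [::] else Err.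
Definition op_elem (v w : cv) : cv :=
  if (tag v == 0) && (tag w == 3) then Cv 2 (lab v) (map tonode (kids w)) else Err.
Definition op_data (w : cv) : cv :=
  if tag w == 3 then
    Cv 3 0 [seq Cv 0 (lab i) [::] | i <- [seq i <- kids w | tag i <= 1]]
  else Err.
Definition op_name (v : cv) : cv :=
  if tag v == 2 then Cv 0 (lab v) [::] else Err.
Definition op_children (w : cv) : cv :=
  if (tag w == 3) && all (fun i => ~~ (tag i == 0)) (kids w) then
    Cv 3 0 (flatten [seq kids i | i <- [seq i <- kids w | tag i == 2]])
  else Err.
Definition op_single (v : cv) : cv :=
  if tag v <= 2 then Cv 3 0 [:: v] else Err.
Definition op_comma (v w : cv) : cv :=
  if (tag v == 3) && (tag w == 3) then Cv 3 0 (kids v ++ kids w) else Err.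
Definition op_for (p : nat -> bool) (w : cv) (F : cv -> cv) : cv :=
  if (tag w == 3) &&
     all (fun i => tag (F i) == 3) [seq i <- kids w | p (tag i)]
  then Cv 3 0 (flatten [seq kids (F i) | i <- [seq i <- kids w | p (tag i)]])
  else Err.
Definition op_if (v1 v2 v3 v4 : cv) : cv :=
  if (tag v1 == 0) && (tag v2 == 0) then
    if lab v1 == lab v2 then v3 else v4
  else Err.

Definition upd (s : nat -> cv) (x : nat) (v : cv) : nat -> cv :=
  fun y => if y == x then v else s y.

Fixpoint ckind (k : kind) (g : nat) : bool :=
  match k with
  | Katom => g == 0
  | Kdata => g == 1
  | Kelem => g == 2
  | Kunion k1 k2 => ckind k1 g || ckind k2 g
  end.

Fixpoint ceval (e : expr) (s : nat -> cv) : cv :=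
  match e with
  | Evar x => s x
  | Etext e1 => op_text (ceval e1 s)
  | Eelem e1 e2 => op_elem (ceval e1 s) (ceval e2 s)
  | Edata e1 => op_data (ceval e1 s)
  | Ename e1 => op_name (ceval e1 s)
  | Echildren e1 => op_children (ceval e1 s)
  | Eempty => Cv 3 0 [::]
  | Esingleton e1 => op_single (ceval e1 s)
  | Ecomma e1 e2 => op_comma (ceval e1 s) (ceval e2 s)
  | Efor x k e1 e2 =>
      op_for (ckind k) (ceval e1 s) (fun i => ceval e2 (upd s x i))
  | Eif e1 e2 e3 e4 =>
      op_if (ceval e1 s) (ceval e2 s) (ceval e3 s) (ceval e4 s)
  end.

(** * Monotonicity of evaluation *)

Lemma op_text_mono x y : le_top x y -> le_top (op_text x) (op_text y).
Proof.
rewrite {1}/le_top; case: eqP => [e _|_ /= /leP[e1 e2 _]].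
  by rewrite /op_text e.
by rewrite /op_text e1 e2 le_top_refl.
Qed.

Lemma op_name_mono x y : le_top x y -> le_top (op_name x) (op_name y).
Proof.
rewrite {1}/le_top; case: eqP => [e _|_ /= /leP[e1 e2 _]].
  by rewrite /op_name e.
by rewrite /op_name e1 e2 le_top_refl.
Qed.

Lemma tonode_mono x y : le x y -> le (tonode x) (tonode y).
Proof.
move=> /[dup] xy /leP[e1 e2 _]; rewrite /tonode e1 e2; case: eqP => // _.
exact: le_refl.
Qed.

Lemma op_elem_mono x y x' y' :
  le_top x y -> le_top x' y' -> le_top (op_elem x x') (op_elem y y').
Proof.
rewrite {1 2}/le_top; case: eqP => [e _|_ /= /leP[e1 e2 _]].
  by rewrite /op_elem e.
case: eqP => [e _|_ /= /leP[e3 e4 H]].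
  by rewrite /op_elem e andbF.
rewrite /op_elem e1 e3 e2; case: ifP => // _; apply/le_le_top/leP; split=> //= u.
case/mapP=> i /H [j jy ij] ->; exists (tonode j); first exact: map_f.
exact: tonode_mono.
Qed.

Lemma op_data_mono x y : le_top x y -> le_top (op_data x) (op_data y).
Proof.
rewrite {1}/le_top; case: eqP => [e _|_ /= /leP[e1 e2 H]].
  by rewrite /op_data e.
rewrite /op_data e1; case: ifP => // _; apply/le_le_top/leP; split=> //= u.
case/mapP=> i; rewrite mem_filter => /andP[gi /H [j jy /leP[e3 e4 _]]] ->.
exists (Cv 0 (lab j) [::]); last by rewrite e4 le_refl.
by apply/mapP; exists j => //; rewrite mem_filter -e3 gi.
Qed.

(** An atom in [x] lies below an atom in [y]; so either the right side is undefined, hence top, or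
    neither argument contains an atom. *)
Lemma op_children_mono x y : le_top x y -> le_top (op_children x) (op_children y).
Proof.
rewrite {1}/le_top; case: eqP => [e _|_ /= /leP[e1 e2 H]].
  by rewrite /op_children e.
rewrite /op_children e1; case: eqP => //= _.
case: (boolP (all _ (kids y))) => //= ay; rewrite ifT.
  apply/le_le_top/leP; split=> //= u /flatten_mapP[i].
  rewrite mem_filter => /andP[/eqP gi /H[j jy /leP[e3 e4 K]]] /K [v vj uv].
  exists v => //; apply/flatten_mapP; exists j => //.
  by rewrite mem_filter -e3 gi.
by apply/allP => i /H [j /(allP ay) tj /leP[-> _ _]].
Qed.

Lemma op_single_mono x y : le_top x y -> le_top (op_single x) (op_single y).
Proof.
rewrite {1}/le_top; case: eqP => [e _|_ /= /[dup] xy /leP[e1 e2 H]].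
  by rewrite /op_single e.
rewrite /op_single e1; case: ifP => // _; apply/le_le_top/leP; split=> //= u.
by rewrite inE => /eqP ->; exists y; rewrite ?inE.
Qed.

Lemma op_comma_mono x y x' y' :
  le_top x y -> le_top x' y' -> le_top (op_comma x x') (op_comma y y').
Proof.
rewrite {1 2}/le_top; case: eqP => [e _|_ /= /leP[e1 e2 H1]].
  by rewrite /op_comma e.
case: eqP => [e _|_ /= /leP[e3 e4 H2]].
  by rewrite /op_comma e andbF.
rewrite /op_comma e1 e3; case: ifP => // _; apply/le_le_top/leP; split=> //= u.
rewrite mem_cat => /orP[/H1|/H2] [v vy uv]; exists v => //;
by rewrite mem_cat vy ?orbT.
Qed.

(** Comparable atoms have equal labels, so when the tests on the right are defined both sides take
    the same branch. *)
Lemma op_if_mono x1 x2 x3 x4 y1 y2 y3 y4 :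
  le_top x1 y1 -> le_top x2 y2 -> le_top x3 y3 -> le_top x4 y4 ->
  le_top (op_if x1 x2 x3 x4) (op_if y1 y2 y3 y4).
Proof.
rewrite {1 2}/le_top; case: eqP => [e _|_ /= /leP[e1 e2 H1]].
  by rewrite /op_if e.
case: eqP => [e _|_ /= /leP[e3 e4 H2]].
  by rewrite /op_if e andbF.
by rewrite /op_if e1 e2 e3 e4; case: ifP => // _; case: ifP.
Qed.

Lemma op_for_mono p x y F G :
  le_top x y -> (forall i j, le i j -> le_top (F i) (G j)) ->
  le_top (op_for p x F) (op_for p y G).
Proof.
move=> xy FG; move: xy; rewrite {1}/le_top.
case: eqP => [e _|_ /= /leP[e1 e2 H]].
  by rewrite /op_for e.
rewrite /op_for e1; case: eqP => //= _.
case: (boolP (all _ [seq i <- kids y | _])) => //= ay.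
have {}FG i j : j \in kids y -> p (tag j) -> le i j -> le (F i) (G j).
  move=> jy pj /FG /le_top_le; apply.
  by have /eqP -> : tag (G j) == 3 by apply: (allP ay); rewrite mem_filter pj.
have {}H i : i \in [seq i <- kids x | p (tag i)] ->
    exists2 j, j \in [seq i <- kids y | p (tag i)] & le (F i) (G j).
  rewrite mem_filter => /andP[pi /H [j jy /[dup] ij /leP[e _ _]]].
  by exists j; [rewrite mem_filter -e pi | apply: FG; rewrite // -e].
rewrite ifT.
  apply/le_le_top/leP; split=> //= u /flatten_mapP[i /H [j jy /leP[_ _ K]] /K[v vj uv]].
  by exists v => //; apply/flatten_mapP; exists j.
by apply/allP => i /H [j /(allP ay) /eqP tj /leP[-> _ _]]; rewrite tj.
Qed.

Definition ele (s s' : nat -> cv) : Prop := forall x, le (s x) (s' x).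

Lemma ele_upd s s' x i j : ele s s' -> le i j -> ele (upd s x i) (upd s' x j).
Proof. by move=> h ij y; rewrite /upd; case: eqP. Qed.

Lemma ceval_mono (e : expr) s s' : ele s s' -> le_top (ceval e s) (ceval e s').
Proof.
elim: e s s' => /=.
- by move=> x s s' h; exact/le_le_top/h.
- by move=> e IH s s' h; exact/op_text_mono/IH.
- by move=> e1 IH1 e2 IH2 s s' h; apply: op_elem_mono; [exact: IH1|exact: IH2].
- by move=> e IH s s' h; exact/op_data_mono/IH.
- by move=> e IH s s' h; exact/op_name_mono/IH.
- by move=> e IH s s' h; exact/op_children_mono/IH.
- by move=> *; exact: le_top_refl.
- by move=> e IH s s' h; exact/op_single_mono/IH.
- by move=> e1 IH1 e2 IH2 s s' h; apply: op_comma_mono; [exact: IH1|exact: IH2].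
- move=> x k e1 IH1 e2 IH2 s s' h; apply: op_for_mono; first exact: IH1.
  by move=> i j ij; apply/IH2/ele_upd.
- by move=> e1 H1 e2 H2 e3 H3 e4 H4 s s' h; apply: op_if_mono;
    [exact: H1|exact: H2|exact: H3|exact: H4].
Qed.

(** * Small approximations that force a given result *)

(** How large the values of an environment must be to force a result above a value of size [k].
    Single operations need arguments of size at most [2k+1]; the doubling comes from [children],
    where each required node is given a parent. Sums appear because the approximations made for
    several subexpressions are joined. A loop uses one approximation per required member, at most
    [k] of them. Each serves the body and also forces into the range the part of the loop variable
    that the body consumes, whence the nested bound; its [.+1] is the root of the singleton
    range. *)
Fixpoint bnd (e : expr) (k : nat) : nat :=
  match e with
  | Evar _ | Eempty => k.+1
  | Etext e1 | Edata e1 | Ename e1 | Echildren e1 | Esingleton e1 =>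
      bnd e1 k.*2.+1
  | Eelem e1 e2 | Ecomma e1 e2 => bnd e1 k.*2.+1 + bnd e2 k.*2.+1
  | Efor _ _ e1 e2 => (k * (bnd e1 (bnd e2 k.+1).+1 + bnd e2 k.+1)).+1
  | Eif e1 e2 e3 e4 =>
      bnd e1 k.*2.+1 + bnd e2 k.*2.+1 + (bnd e3 k.*2.+1 + bnd e4 k.*2.+1)
  end.

Lemma bnd_mono (e : expr) k l : k <= l -> bnd e k <= bnd e l.
Proof.
elim: e k l => //=.
- by move=> e IH k l kl; apply: IH; lia.
- by move=> e1 IH1 e2 IH2 k l kl; apply: leq_add; [apply: IH1|apply: IH2]; lia.
- by move=> e IH k l kl; apply: IH; lia.
- by move=> e IH k l kl; apply: IH; lia.
- by move=> e IH k l kl; apply: IH; lia.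
- by move=> e IH k l kl; apply: IH; lia.
- by move=> e1 IH1 e2 IH2 k l kl; apply: leq_add; [apply: IH1|apply: IH2]; lia.
- move=> _ _ e1 IH1 e2 IH2 k l kl; rewrite ltnS; apply: leq_mul => //.
  have h : bnd e2 k.+1 <= bnd e2 l.+1 by apply: IH2.
  by apply: leq_add => //; apply: IH1.
- move=> e1 H1 e2 H2 e3 H3 e4 H4 k l kl.
  by rewrite !leq_add // ?(H1, H2, H3, H4) //; lia.
Qed.

Lemma seq_choice (P : cv -> cv -> Prop) (s : seq cv) :
  (forall x, x \in s -> exists y, P x y) ->
  exists F, forall x, x \in s -> P x (F x).
Proof.
move=> H; have /choice[F HF] : forall x, exists y, x \in s -> P x y.
  by move=> x; case: (boolP (x \in s)) => [/H [y Py]|_]; [exists y|exists x].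
by exists F.
Qed.

Lemma sumn_map_leq (F : cv -> cv) (s : seq cv) c :
  (forall x, x \in s -> csize (F x) <= c * csize x) ->
  sumn (map csize (map F s)) <= c * sumn (map csize s).
Proof.
elim: s => //= x s IH H; rewrite mulnDr leq_add ?H ?inE ?eqxx //.
by apply: IH => y ys; rewrite H // inE ys orbT.
Qed.

(** Finitarity with an explicit modulus. Choosing [v0] with tag 4 makes it a statement about forcing
    undefinedness. *)
Definition cont1 (o : cv -> cv) : Prop := forall v v0, le_top v0 (o v) ->
  exists u, [/\ le_top u v, csize u <= (csize v0).*2.+1 & le_top v0 (o u)].

Lemma le_top_bot x : le_top (bot x) x. Proof. exact/le_le_top/le_bot. Qed.

Lemma cont_text : cont1 op_text.
Proof. by move=> v v0 h; exists (bot v); split; first exact: le_top_bot. Qed.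

Lemma cont_name : cont1 op_name.
Proof. by move=> v v0 h; exists (bot v); split; first exact: le_top_bot. Qed.

Lemma cont_data : cont1 op_data.
Proof.
move=> v v0; rewrite {1}/op_data; case: eqP => [tv|tv]; last first.
  exists (bot v); split; [exact: le_top_bot|by []|].
  by rewrite /op_data /=; case: eqP.
move=> /le_top_le h; have {h} /leP[/= t0 l0 H] := h ltac:(by []).
have /seq_choice[F HF] : forall x, x \in kids v0 ->
    exists i, [&& i \in kids v, tag i <= 1 & le x (Cv 0 (lab i) [::])].
  move=> x /H[y /mapP[i]]; rewrite mem_filter => /andP[ti iv] -> xi.
  by exists i; rewrite iv ti xi.
exists (Cv 3 (lab v) [seq bot (F x) | x <- kids v0]); split.
- apply/le_le_top/leP; split=> //= u /mapP[x /HF /and3P[Fv _ _] ->].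
  by exists (F x) => //; exact: le_bot.
- have h (x : cv) : x \in kids v0 -> csize (bot (F x)) <= 1 * csize x.
    by rewrite mul1n => _; exact: csize_gt0.
  by rewrite /= csizeE; have := sumn_map_leq h; lia.
- apply/le_le_top/leP; split=> //= u /[dup] uv /HF /and3P[_ tF uF].
  exists (Cv 0 (lab (F u)) [::]) => //; apply/mapP; exists (bot (F u)) => //.
  by rewrite mem_filter /= tF; apply/mapP; exists u.
Qed.

Lemma cont_children : cont1 op_children.
Proof.
move=> v v0; rewrite {1}/op_children; case: eqP => [tv|tv] /=; last first.
  exists (bot v); split; [exact: le_top_bot|by []|].
  by rewrite /op_children /=; case: eqP.
case: (boolP (all _ _)) => [av|/allPn[i iv /negPn ti]]; last first.
  (* A single atom of the argument is enough to keep the result undefined. *)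
  move=> _; exists (Cv 3 (lab v) [:: bot i]); split.
  - apply/le_le_top/leP; split=> //= u; rewrite inE => /eqP ->.
    by exists i => //; exact: le_bot.
  - by rewrite /=; have := csize_gt0 v0; lia.
  - by rewrite /op_children /= ti.
move=> /le_top_le h; have {h} /leP[/= t0 l0 H] := h ltac:(by []).
have /seq_choice[F HF] : forall x, x \in kids v0 ->
    exists i, [/\ i \in kids v, tag i = 2 & has (le x) (kids i)].
  move=> x /H[y /flatten_mapP[i]]; rewrite mem_filter => /andP[/eqP ti iv] yi xy.
  by exists i; split=> //; apply/hasP; exists y.
(* Every required node gets a parent of its own, which at most doubles the size. *)
exists (Cv 3 (lab v) [seq Cv 2 (lab (F x)) [:: x] | x <- kids v0]); split.
- apply/le_le_top/leP; split=> //= u /mapP[x /HF [Fv tF hF] ->].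
  exists (F x) => //; apply/leP; split=> //= w; rewrite inE => /eqP ->.
  exact/hasP.
- have h (x : cv) : x \in kids v0 -> csize (Cv 2 (lab (F x)) [:: x]) <= 2 * csize x.
    by move=> _ /=; have := csize_gt0 x; lia.
  by rewrite /= csizeE; have := sumn_map_leq h; lia.
- rewrite /op_children /= ifT; last by apply/allP => w /mapP[x _ ->].
  apply/le_le_top/leP; split=> //= u /[dup] uv /HF [_ tF uF].
  exists u; last exact: le_refl.
  apply/flatten_mapP; exists (Cv 2 (lab (F u)) [:: u]); last by rewrite inE.
  by rewrite mem_filter /=; apply/mapP; exists u.
Qed.

Lemma sumn_flatten_kids (s : seq cv) :
  sumn (map csize (flatten (map kids s))) <= sumn (map csize s).
Proof.
by elim: s => //= x s IH; rewrite map_cat sumn_cat [csize x]csizeE; lia.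
Qed.

(** All members of [v0] lie below the one item [v]. The argument needed is their join, whose kids
    are the grandchildren in [v0]. *)
Lemma cont_single : cont1 op_single.
Proof.
move=> v v0; rewrite {1}/op_single; case: ifP => tv; last first.
  exists (bot v); split; [exact: le_top_bot|by []|].
  by rewrite /op_single /= tv.
move=> /le_top_le h; have {h} /leP[/= t0 l0 H] := h ltac:(by []).
exists (Cv (tag v) (lab v) (flatten (map kids (kids v0)))); split.
- apply/le_le_top/leP; split=> //= u /flatten_mapP[x /H[y]].
  by rewrite inE => /eqP -> /leP[_ _]; exact.
- by rewrite [csize v0]csizeE /=; have := sumn_flatten_kids (kids v0); lia.
- rewrite /op_single /= tv; apply/le_le_top/leP; split=> //= x xv.
  have [y] := H x xv; rewrite inE => /eqP -> /leP[e1 e2 e3].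
  eexists; first by rewrite inE.
  apply/leP; split=> //= w wx; exists w; last exact: le_refl.
  by apply/flatten_mapP; exists x.
Qed.

Definition cont2 (o : cv -> cv -> cv) : Prop := forall v w v0, le_top v0 (o v w) ->
  exists u1 u2, [/\ le_top u1 v, le_top u2 w, csize u1 <= (csize v0).*2.+1,
                    csize u2 <= (csize v0).*2.+1 & le_top v0 (o u1 u2)].

Lemma cont_elem : cont2 op_elem.
Proof.
move=> v w v0; rewrite {1}/op_elem; case: ifP => tvw; last first.
  exists (bot v), (bot w); split=> //; try exact: le_top_bot.
  by rewrite /op_elem /= tvw.
have /andP[/eqP tv /eqP tw] := tvw.
move=> /le_top_le h; have {h} /leP[/= t0 l0 H] := h ltac:(by []).
(* A required node that stems from an atom of [w] is traced back to that atom; any other required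
   node serves as its own preimage. *)
have /seq_choice[F HF] : forall x, x \in kids v0 ->
    exists y, [/\ has (le y) (kids w), csize y <= 1 * csize x & le x (tonode y)].
  move=> x /H[y /mapP[i iw ->]]; rewrite {1}/tonode; case: eqP => ti xi.
    exists (bot i); split; last by rewrite /tonode /= ti.
      by apply/hasP; exists i => //; exact: le_bot.
    by rewrite mul1n csize_gt0.
  have [e _ _] := leP _ _ xi; exists x; split; rewrite ?mul1n //.
    by apply/hasP; exists i.
  by rewrite /tonode e; case: eqP => // _; exact: le_refl.
exists (bot v), (Cv 3 (lab w) (map F (kids v0))); split.
- exact: le_top_bot.
- apply/le_le_top/leP; split=> //= u /mapP[x /HF[/hasP[i iw Fi] _ _] ->].
  by exists i.
- by [].
- have h (x : cv) : x \in kids v0 -> csize (F x) <= 1 * csize x by move=> /HF[].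
  by rewrite /= [csize v0]csizeE; have := sumn_map_leq h; lia.
- rewrite /op_elem /= tv; apply/le_le_top/leP; split=> //= x xv.
  exists (tonode (F x)); last by have [] := HF x xv.
  by rewrite -map_comp; apply/mapP; exists x.
Qed.

Lemma sumn_filter (p : pred cv) (s : seq cv) :
  sumn (map csize (filter p s)) <= sumn (map csize s).
Proof. by elim: s => //= x s IH; case: (p x) => /=; lia. Qed.

Lemma cont_comma : cont2 op_comma.
Proof.
move=> v w v0; rewrite {1}/op_comma; case: ifP => tvw; last first.
  exists (bot v), (bot w); split=> //; try exact: le_top_bot.
  by rewrite /op_comma /= tvw.
have /andP[/eqP tv /eqP tw] := tvw.
move=> /le_top_le h; have {h} /leP[/= t0 l0 H] := h ltac:(by []).
(* The members of [v0] are distributed over the two arguments according to which side dominates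
   them, possibly both. *)
pose S z := Cv 3 (lab z) [seq x <- kids v0 | has (le x) (kids z)].
have S4 z : tag z = 3 -> le_top (S z) z.
  move=> tz; apply/le_le_top/leP; split=> //= x.
  by rewrite mem_filter => /andP[/hasP].
have Ss z : csize (S z) <= (csize v0).*2.+1.
  rewrite /= [csize v0]csizeE.
  by rewrite ltnS; apply: leq_trans (sumn_filter _ _) _; lia.
exists (S v), (S w); split; rewrite ?S4 ?Ss //.
apply/le_le_top/leP; split=> //= x xv; exists x; last exact: le_refl.
have [y yvw xy] := H x xv; rewrite mem_cat !mem_filter xv !andbT.
by move: yvw; rewrite mem_cat => /orP[yv|yw]; apply/orP; [left|right];
  apply/hasP; exists y.
Qed.

(** A join only for trees with a common upper bound: these agree in root tag and label, so reading
    them off [x] is no choice. *)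
Definition cjoin (x y : cv) : cv := Cv (tag x) (lab x) (kids x ++ kids y).

Lemma cjoinP x y z : le x z -> le y z ->
  [/\ le x (cjoin x y), le y (cjoin x y), le (cjoin x y) z &
      csize (cjoin x y) <= csize x + csize y].
Proof.
move=> /leP[e1 e2 h1] /leP[e3 e4 h2]; split.
- apply/leP; split=> //= u us; exists u; last exact: le_refl.
  by rewrite mem_cat us.
- apply/leP; split; [by rewrite /= e1 e3|by rewrite /= e2 e4|] => u us.
  by exists u; [rewrite mem_cat us orbT|exact: le_refl].
- by apply/leP; split=> //= u; rewrite mem_cat => /orP[/h1|/h2].
- rewrite /= map_cat sumn_cat [csize x]csizeE [csize y]csizeE; lia.
Qed.

Definition ejoin (s s' : nat -> cv) : nat -> cv := fun x => cjoin (s x) (s' x).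

Lemma ejoinP s s' t : ele s t -> ele s' t ->
  [/\ ele s (ejoin s s'), ele s' (ejoin s s'), ele (ejoin s s') t &
      forall x, csize (ejoin s s' x) <= csize (s x) + csize (s' x)].
Proof.
by move=> st s't; split=> x; have [h1 h2 h3 h4] := cjoinP (st x) (s't x).
Qed.

Definition approx (e : expr) (s : nat -> cv) (v0 : cv) (K : nat) : Prop :=
  exists s0, [/\ ele s0 s, forall x, csize (s0 x) <= K & le_top v0 (ceval e s0)].

Lemma approx_leq e s v0 K L : K <= L -> approx e s v0 K -> approx e s v0 L.
Proof.
by move=> KL [s0 [h1 h2 h3]]; exists s0; split=> // x; exact: leq_trans KL.
Qed.

(** Members are forced one at a time and the environments joined. The join stays below [s], where
    the result is a set, so its own result cannot be undefined and the members accumulate. The final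
    [.+1] pays for the environment of [bot]s used when [s0] is empty. *)
Lemma approx_set e s (s0 : seq cv) K :
  tag (ceval e s) = 3 -> lab (ceval e s) = 0 ->
  (forall i, i \in s0 -> approx e s (Cv 3 0 [:: i]) K) ->
  approx e s (Cv 3 0 s0) (size s0 * K).+1.
Proof.
move=> te le0; elim: s0 => [|i s0 IH] H.
  exists (fun x => bot (s x)); split=> // [x|]; first exact: le_bot.
  have /ceval_mono : ele (fun x => bot (s x)) s by move=> x; exact: le_bot.
  move=> /(_ e) /le_top_le; rewrite te => h; have /leP[h1 h2 _] := h ltac:(by []).
  by apply/le_le_top/leP; rewrite h1 h2 te le0.
have [s1 [s1s s1K h1]] : approx e s (Cv 3 0 [:: i]) K by apply: H; rewrite inE eqxx.
have [s2 [s2s s2K h2]] : approx e s (Cv 3 0 s0) (size s0 * K).+1.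
  by apply: IH => j js; apply: H; rewrite inE js orbT.
have [j1 j2 j3 j4] := ejoinP s1s s2s.
exists (ejoin s1 s2); split=> // [x|].
  by apply: leq_trans (j4 x) _; have := s1K x; have := s2K x; rewrite /= mulSn; lia.
have t4 : tag (ceval e (ejoin s1 s2)) <> 4.
  by move=> h; have := le_top_tag (ceval_mono e j3) h; rewrite te.
have /le_top_le/(_ t4)/leP[t3 l0 h3] := le_top_trans h1 (ceval_mono e j1).
have /le_top_le/(_ t4)/leP[_ _ h4] := le_top_trans h2 (ceval_mono e j2).
apply/le_le_top/leP; split=> //= u; rewrite inE => /predU1P[->|/h4 //].
by apply: h3; rewrite inE.
Qed.

Definition small (e : expr) : Prop := forall s v0,
  le_top v0 (ceval e s) -> approx e s v0 (bnd e (csize v0)).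

Lemma small1 o e1 s v0 : cont1 o -> (forall x y, le_top x y -> le_top (o x) (o y)) ->
  small e1 -> le_top v0 (o (ceval e1 s)) ->
  exists s0, [/\ ele s0 s, forall x, csize (s0 x) <= bnd e1 (csize v0).*2.+1 &
                 le_top v0 (o (ceval e1 s0))].
Proof.
move=> co mo IH /co[u [uv su vu]]; have [s0 [h1 h2 h3]] := IH _ _ uv.
exists s0; split=> // [x|]; first by apply: leq_trans (h2 x) (bnd_mono _ su).
exact: le_top_trans vu (mo _ _ h3).
Qed.

Lemma small2 o e1 e2 s v0 : cont2 o ->
  (forall x y x' y', le_top x y -> le_top x' y' -> le_top (o x x') (o y y')) ->
  small e1 -> small e2 -> le_top v0 (o (ceval e1 s) (ceval e2 s)) ->
  exists s0, [/\ ele s0 s,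
    forall x, csize (s0 x) <= bnd e1 (csize v0).*2.+1 + bnd e2 (csize v0).*2.+1 &
    le_top v0 (o (ceval e1 s0) (ceval e2 s0))].
Proof.
move=> co mo IH1 IH2 /co[u1 [u2 [uv1 uv2 su1 su2 vu]]].
have [s1 [h1 h2 h3]] := IH1 _ _ uv1; have [s2 [h4 h5 h6]] := IH2 _ _ uv2.
have [j1 j2 j3 j4] := ejoinP h1 h4.
exists (ejoin s1 s2); split=> // [x|].
  apply: leq_trans (j4 x) _; apply: leq_add.
    by apply: leq_trans (h2 x) (bnd_mono _ su1).
  by apply: leq_trans (h5 x) (bnd_mono _ su2).
apply: le_top_trans vu _; apply: mo.
  exact: le_top_trans h3 (ceval_mono _ j1).
exact: le_top_trans h6 (ceval_mono _ j2).
Qed.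

Lemma small_if e1 e2 e3 e4 :
  small e1 -> small e2 -> small e3 -> small e4 -> small (Eif e1 e2 e3 e4).
Proof.
move=> H1 H2 H3 H4 s v0 /= h; set k := (csize v0).*2.+1.
have k1 : 1 <= k by []. have kv : csize v0 <= k by rewrite /k; lia.
have [s1 [a1 b1 c1]] := H1 s _ (le_top_bot _).
have [s2 [a2 b2 c2]] := H2 s _ (le_top_bot _).
(* Only the branch taken has to reach [v0]; the other receives a one-node target, so that all cases
   can be joined uniformly. *)
have [w3 [w4 [w3s w4s sw3 sw4 hw]]] : exists w3 w4,
    [/\ le_top w3 (ceval e3 s), le_top w4 (ceval e4 s), csize w3 <= k, csize w4 <= k &
      le_top v0 (op_if (bot (ceval e1 s)) (bot (ceval e2 s)) w3 w4)].
  move: h; rewrite /op_if /=; case: ifP => _; last first.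
    by exists (bot (ceval e3 s)), (bot (ceval e4 s)); split; rewrite ?le_top_bot.
  case: ifP => _ h.
    by exists v0, (bot (ceval e4 s)); split; rewrite ?le_top_bot ?le_top_refl.
  by exists (bot (ceval e3 s)), v0; split; rewrite ?le_top_bot ?le_top_refl.
have [s3 [a3 b3 c3]] := H3 _ _ w3s; have [s4 [a4 b4 c4]] := H4 _ _ w4s.
have [p1 p2 p3 p4] := ejoinP a1 a2; have [q1 q2 q3 q4] := ejoinP a3 a4.
have [r1 r2 r3 r4] := ejoinP p3 q3.
exists (ejoin (ejoin s1 s2) (ejoin s3 s4)); split=> // [x|].
  apply: leq_trans (r4 x) _; apply: leq_add.
    apply: leq_trans (p4 x) _; apply: leq_add.
      by apply: leq_trans (b1 x) (bnd_mono _ _).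
    by apply: leq_trans (b2 x) (bnd_mono _ _).
  apply: leq_trans (q4 x) _; apply: leq_add.
    by apply: leq_trans (b3 x) (bnd_mono _ _).
  by apply: leq_trans (b4 x) (bnd_mono _ _).
apply: le_top_trans hw _ => /=; apply: op_if_mono.
- exact: le_top_trans (le_top_trans c1 (ceval_mono _ p1)) (ceval_mono _ r1).
- exact: le_top_trans (le_top_trans c2 (ceval_mono _ p2)) (ceval_mono _ r1).
- exact: le_top_trans (le_top_trans c3 (ceval_mono _ q1)) (ceval_mono _ r2).
- exact: le_top_trans (le_top_trans c4 (ceval_mono _ q2)) (ceval_mono _ r2).
Qed.

(* From an approximation of the body at an element [i] of the range, one of the
   loop: the part of [i] that the body needs is itself an approximation of the
   range. *)
Lemma approx_for x e1 e2 s i u :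
  small e1 -> small e2 ->
  tag (ceval e1 s) = 3 -> i \in kids (ceval e1 s) ->
  le_top u (ceval e2 (upd s x i)) ->
  exists s0, [/\ ele s0 s, forall y, csize (s0 y) <=
      bnd e1 (bnd e2 (csize u)).+1 + bnd e2 (csize u) &
    tag (ceval e1 s0) <> 4 -> exists j, [/\ j \in kids (ceval e1 s0),
      tag j = tag i & le_top u (ceval e2 (upd s0 x j))]].
Proof.
move=> H1 H2 te ik /H2[t [ts tK ht]].
have tx : le (t x) i by have := ts x; rewrite /upd eqxx.
have le1 : le_top (Cv 3 (lab (ceval e1 s)) [:: t x]) (ceval e1 s).
  by apply/le_le_top/leP; split=> //= w; rewrite inE => /eqP ->; exists i.
have [s1 [a1 b1 c1]] := H1 _ _ le1.
(* At [x] the environment [t] holds the loop variable. Outside the body [x] has its outer value,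
   approximated here by its root. *)
pose t' := upd t x (bot (s x)).
have t's : ele t' s.
  move=> y; rewrite /t' /upd; case: eqP => [->|ne]; first exact: le_bot.
  by have := ts y; rewrite /upd; case: eqP.
have [j1 j2 j3 j4] := ejoinP a1 t's.
exists (ejoin s1 t'); split=> // [y|t4].
  apply: leq_trans (j4 y) _; apply: leq_add.
    apply: leq_trans (b1 y) _; apply: bnd_mono.
    by rewrite /= addn0; exact: tK.
  rewrite /t' /upd; case: eqP => [_|_]; last exact: tK.
  exact: leq_trans (csize_gt0 _) (tK x).
have /le_top_le/(_ t4)/leP[/= _ _ h3] := le_top_trans c1 (ceval_mono e1 j1).
have [|j jk tj] := h3 (t x); first by rewrite inE.
have [e _ _] := leP _ _ tj; have [e' _ _] := leP _ _ tx.
exists j; split; [by []|by rewrite -e e'|].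
apply: le_top_trans ht _; apply: ceval_mono => y; rewrite /upd.
case: eqP => [->//|ne]; have := j2 y; rewrite /t' /upd.
by case: eqP.
Qed.

Lemma small_for x k e1 e2 : small e1 -> small e2 -> small (Efor x k e1 e2).
Proof.
move=> H1 H2 s v0; set K := bnd e1 (bnd e2 (csize v0).+1).+1 + bnd e2 (csize v0).+1.
have bK u : csize u <= (csize v0).+1 ->
    bnd e1 (bnd e2 (csize u)).+1 + bnd e2 (csize u) <= K.
  move=> su; have h := bnd_mono e2 su; rewrite leq_add //.
  exact: bnd_mono.
have v01 := csize_gt0 v0.
have KK : K <= (csize v0 * K).+1.
  by apply: leqW; apply: leq_pmull.
(* An undefined loop has one culprit, the range or a single iteration, so one approximation of size
   [K] suffices. *)
case: (eqVneq (tag (ceval (Efor x k e1 e2) s)) 4) => [t4 _|t4].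
  suff: exists s0, [/\ ele s0 s, forall y, csize (s0 y) <= K &
      tag (ceval (Efor x k e1 e2) s0) = 4].
    case=> s0 [h1 h2 h3]; exists s0; split=> // [y|].
      by apply: leq_trans (h2 y) _.
    by rewrite /le_top h3.
  move: t4; rewrite /= {1}/op_for; case: eqP => /= [te|te _]; last first.
    have [s0 [h1 h2 h3]] := H1 s _ (le_top_bot _).
    exists s0; split=> // [y|].
      apply: leq_trans (h2 y) _; apply: leq_trans (leq_addr _ _).
      by apply: bnd_mono.
    have := h3; rewrite /le_top => /orP[/eqP e4|/leP[/= e4 _ _]].
      by rewrite /op_for e4.
    by rewrite /op_for -e4; case: eqP.
  case: (boolP (all _ _)) => // /allPn[i]; rewrite mem_filter.
  move=> /andP[pi ik] ti _.
  have [s0 [h1 h2 h3]] := approx_for (x := x) H1 H2 te ik (le_top_bot _).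
  exists s0; split=> // [y|]; first by apply: leq_trans (h2 y) _; exact: bK.
  (* If the approximate range is not a set, the loop is undefined at once. Otherwise the failing
     iteration survives at some [j] with the tag of [i], so [j] passes the same kind test. *)
  rewrite /op_for; case: eqP => //= te0.
  have [|j [jk tj hj]] := h3; first by rewrite te0.
  case: ifP => // /allP/(_ j); rewrite mem_filter tj pi jk => /(_ isT)/eqP t3.
  have n4 : tag (ceval e2 (upd s0 x j)) <> 4 by rewrite t3.
  have [/= e3 _ _] := leP _ _ (le_top_le hj n4).
  by rewrite e3 t3 in ti.
move=> /le_top_le h; have {}h := h (elimN eqP t4).
have [te ha] : tag (ceval e1 s) = 3 /\
    {in [seq i <- kids (ceval e1 s) | ckind k (tag i)],
      forall i, tag (ceval e2 (upd s x i)) == 3}.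
  by move: t4; rewrite /= /op_for; case: ifP => [/andP[/eqP te /allP ha]|].
have er : ceval (Efor x k e1 e2) s = Cv 3 0 (flatten [seq kids (ceval e2 (upd s x i))
    | i <- [seq i <- kids (ceval e1 s) | ckind k (tag i)]]).
  by rewrite /= /op_for te /= ifT //; apply/allP.
move: h; rewrite er => /leP[/= t3 l0 H].
have e0 : v0 = Cv 3 0 (kids v0) by case: (v0) t3 l0 => /= g a s0 -> ->.
rewrite [v in approx _ _ v _]e0.
suff: approx (Efor x k e1 e2) s (Cv 3 0 (kids v0)) (size (kids v0) * K).+1.
  apply: approx_leq; rewrite /= ltnS leq_mul // csizeE.
  by have := size_leq_csize (kids v0); lia.
apply: approx_set; rewrite ?er // => i0 iv.
have [w /flatten_mapP[i ik wi] iw] := H i0 iv.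
have t3i := ha i ik; move: ik; rewrite mem_filter => /andP[pi ik].
have hu : le_top (Cv 3 (lab (ceval e2 (upd s x i))) [:: i0]) (ceval e2 (upd s x i)).
  apply/le_le_top/leP; split=> //=; first by rewrite (eqP t3i).
  by move=> z; rewrite inE => /eqP ->; exists w.
have [s0 [h1 h2 h3]] := approx_for H1 H2 te ik hu.
exists s0; split=> // [y|].
  apply: leq_trans (h2 y) _; apply: bK; rewrite /= addn0.
  by rewrite [csize v0]csizeE; have := csize_mem iv; lia.
(* Should the loop be undefined at [s0], its result is top and there is nothing to show. *)
rewrite /= /op_for; case: ifP => // /andP[/eqP te0 /allP ha0].
have [|j [jk tj hj]] := h3; first by rewrite te0.
have jf : j \in [seq i <- kids (ceval e1 s0) | ckind k (tag i)].
  by rewrite mem_filter tj pi.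
have /eqP tj3 := ha0 j jf.
move: hj; rewrite /le_top tj3 /= => /and3P[_ _]; rewrite andbT => /hasP[z zj iz].
rewrite andbT; apply/hasP; exists z => //.
by apply/flatten_mapP; exists j.
Qed.

Lemma smallP (e : expr) : small e.
Proof.
elim: e.
- move=> x s v0 /= h.
  case: (eqVneq (tag (s x)) 4) => [t4|/eqP t4].
    exists (fun y => bot (s y)); split=> [y|//|]; first exact: le_bot.
    by rewrite /le_top /= t4.
  exists (upd (fun y => bot (s y)) x v0); split=> [y|y|].
  - by rewrite /upd; case: eqP => [->|_]; [exact: le_top_le h t4|exact: le_bot].
  - by rewrite /upd; case: eqP => // _; exact: leqnSn.
  - by rewrite /= /upd eqxx le_top_refl.
- by move=> e IH s v0; apply: small1 cont_text op_text_mono IH.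
- by move=> e1 IH1 e2 IH2 s v0; apply: small2 cont_elem op_elem_mono IH1 IH2.
- by move=> e IH s v0; apply: small1 cont_data op_data_mono IH.
- by move=> e IH s v0; apply: small1 cont_name op_name_mono IH.
- by move=> e IH s v0; apply: small1 cont_children op_children_mono IH.
- by move=> s v0 h; exists (fun y => bot (s y)); split=> // y; exact: le_bot.
- by move=> e IH s v0; apply: small1 cont_single op_single_mono IH.
- by move=> e1 IH1 e2 IH2 s v0; apply: small2 cont_comma op_comma_mono IH1 IH2.
- by move=> x k e1 IH1 e2 IH2; exact: small_for.
- by move=> e1 H1 e2 H2 e3 H3 e4 H4; exact: small_if.
Qed.

(** * Types on trees and small witnesses of non-membership *)

Fixpoint cntype (t : ntype) (v : cv) : bool :=
  match t with
  | Tdata => tag v == 1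
  | Telem ts =>
      (tag v == 2) && all (fun m => has (fun t' => cntype t' m) ts) (kids v)
  end.

Fixpoint citype (t : itype) (v : cv) : bool :=
  match t with
  | Tatom => tag v == 0
  | Tnode t1 => cntype t1 v
  | Tiunion t1 t2 => citype t1 v || citype t2 v
  end.

Fixpoint ctype (t : rxtype) (v : cv) : bool :=
  match t with
  | Tcoll t1 => (tag v == 3) && all (citype t1) (kids v)
  | Titem t1 => citype t1 v
  | Tunion t1 t2 => ctype t1 v || ctype t2 v
  end.

Definition accept (t : option rxtype) (v : cv) : bool :=
  ~~ (tag v == 4) && (if t is Some t' then ctype t' v else true).

Lemma ntype_ind_foldr (P : ntype -> Prop) :
  P Tdata ->
  (forall ts, foldr (fun t => and (P t)) True ts -> P (Telem ts)) ->
  forall t, P t.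
Proof.
move=> Hd He; fix loop 1; case=> [|ts]; first exact: Hd.
apply: He; elim: ts => [|r s IHs]; first exact: I.
by split; [exact: loop | exact: IHs].
Qed.

Lemma cntype_le t x y : le x y -> cntype t y -> cntype t x.
Proof.
elim/ntype_ind_foldr: t x y => [|ts IH] x y /leP[e _ H] /=; rewrite e //.
case/andP=> -> /allP h; apply/allP => u /H[v /h hv uv]; move: hv.
elim: ts IH {h} => //= t ts IH [Ht /IH{}IH] /orP[/(Ht _ _ uv) ->//|/IH ->].
by rewrite orbT.
Qed.

Lemma citype_le t x y : le x y -> citype t y -> citype t x.
Proof.
elim: t => /= [|t|t1 IH1 t2 IH2] xy.
- by have [-> _ _] := leP _ _ xy.
- exact: cntype_le xy.
- by move: xy; move=> xy /orP[/(IH1 xy)|/(IH2 xy)] ->; rewrite ?orbT.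
Qed.

Lemma ctype_le t x y : le x y -> ctype t y -> ctype t x.
Proof.
elim: t => /= [t|t|t1 IH1 t2 IH2]; last 2 first.
- exact: citype_le.
- by move=> xy /orP[/(IH1 xy)|/(IH2 xy)] ->; rewrite ?orbT.
move=> /leP[-> _ H] /andP[-> /allP h]; apply/allP => u /H[v /h hv uv].
exact: citype_le uv hv.
Qed.

Fixpoint dsize (d : dtree) : nat :=
  if d is Dcons a b then (dsize a + dsize b).+1 else 1.

Lemma dsize_gt0 d : 0 < dsize d. Proof. by case: d. Qed.

(** To escape a union, take a witness against each alternative and join them: by downward closure
    the join still avoids every alternative, and the sizes add up like those of the type codes. *)
Lemma cntype_witness t v : ~~ cntype t v ->
  exists w, [/\ le w v, csize w <= dsize (dntype t) & ~~ cntype t w].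
Proof.
elim/ntype_ind_foldr: t v => [|ts IH] v /= tv.
  by exists (bot v); split=> //; exact: le_bot.
move: tv; rewrite negb_and; case: (boolP (tag v == 2)) => /= [/eqP tv|tv _].
  case/allPn=> m mv hm.
  have [w [wm sw nw]] : exists w, [/\ le w m,
      csize w <= dsize (dseq (map dntype ts)) &
      ~~ has (fun t' => cntype t' w) ts].
    elim: ts IH hm => [|t ts IH] /=.
      by move=> _ _; exists (bot m); split=> //; exact: le_bot.
    case=> Ht /IH{}IH; rewrite negb_or => /andP[/Ht[w1 [h1 h2 h3]]].
    move=> /IH[w2 [k1 k2 k3]]; have [j1 j2 j3 j4] := cjoinP h1 k1.
    exists (cjoin w1 w2); split=> //.
      by apply: leq_trans j4 _; apply: leqW; exact: leq_add.
    rewrite negb_or (contraNN (cntype_le j1) h3) /=.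
    apply: contraNN k3; elim: (ts) => //= t' ts' IH' /orP[/(cntype_le j2)->//|/IH' ->].
    by rewrite orbT.
  exists (Cv 2 (lab v) [:: w]); split.
  - by apply/leP; split=> //= u; rewrite inE => /eqP ->; exists m.
  - by rewrite /=; lia.
  - by rewrite /= andbT.
by exists (bot v); split; rewrite ?le_bot //= (negPf tv).
Qed.

Lemma citype_witness t v : ~~ citype t v ->
  exists w, [/\ le w v, csize w <= dsize (ditype t) & ~~ citype t w].
Proof.
elim: t v => /= [|t|t1 IH1 t2 IH2] v.
- by move=> tv; exists (bot v); split; rewrite ?le_bot.
- by move=> /cntype_witness[w [h1 h2 h3]]; exists w; split=> //; lia.
rewrite negb_or => /andP[/IH1[w1 [h1 h2 h3]] /IH2[w2 [k1 k2 k3]]].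
have [j1 j2 j3 j4] := cjoinP h1 k1; exists (cjoin w1 w2); split=> //.
  by lia.
by rewrite negb_or (contraNN (citype_le j1) h3) (contraNN (citype_le j2) k3).
Qed.

Lemma ctype_witness t v : ~~ ctype t v ->
  exists w, [/\ le w v, csize w <= dsize (dtype t) & ~~ ctype t w].
Proof.
elim: t v => /= [t|t|t1 IH1 t2 IH2] v.
- rewrite negb_and; case: (boolP (tag v == 3)) => /= [/eqP tv|tv _].
    case/allPn=> m mv /citype_witness[w [wm sw nw]].
    exists (Cv 3 (lab v) [:: w]); split.
    + by apply/leP; split=> //= u; rewrite inE => /eqP ->; exists m.
    + by have := dsize_gt0 (ditype t); rewrite /=; lia.
    + by rewrite /= andbT.
  by exists (bot v); split; rewrite ?le_bot //= (negPf tv).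
- by move=> /citype_witness[w [h1 h2 h3]]; exists w; split=> //; lia.
rewrite negb_or => /andP[/IH1[w1 [h1 h2 h3]] /IH2[w2 [k1 k2 k3]]].
have [j1 j2 j3 j4] := cjoinP h1 k1; exists (cjoin w1 w2); split=> //.
  by lia.
by rewrite negb_or (contraNN (ctype_le j1) h3) (contraNN (ctype_le j2) k3).
Qed.

(** Without a type, the witness is the root of an undefined result, of size 1. *)
Definition csz (t : option rxtype) : nat :=
  if t is Some t' then dsize (dtype t') else 1.

Lemma accept_le_top t x y : le_top x y -> accept t y -> accept t x.
Proof.
rewrite /accept => xy /andP[ty cy]; rewrite (contraNN _ ty) /=; last first.
  by move=> /eqP/(le_top_tag xy) ->.
case: t cy => // t; apply: ctype_le; apply: le_top_le xy _.
exact: (elimN eqP ty).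
Qed.

Lemma accept_witness t v : ~~ accept t v ->
  exists w, [/\ le_top w v, csize w <= csz t & ~~ accept t w].
Proof.
rewrite /accept; case: (boolP (tag v == 4)) => [tv _|tv] /=.
  exists (bot v); split; [exact: le_top_bot| |by rewrite /= tv].
  by case: t => //= t; exact: dsize_gt0.
case: t => //= t /ctype_witness[w [h1 h2 h3]].
exists w; split=> //; first exact: le_le_top.
by rewrite negb_and h3 orbT.
Qed.

(** * Invariance under renaming of atoms *)

Section Renaming.

Variable r : nat -> nat.
Hypothesis r_inj : injective r.
Hypothesis r0 : r 0 = 0.

Fixpoint cren (t : cv) : cv := let: Cv g a s := t in Cv g (r a) (map cren s).

Lemma tag_cren t : tag (cren t) = tag t. Proof. by case: t. Qed.
Lemma lab_cren t : lab (cren t) = r (lab t). Proof. by case: t. Qed.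
Lemma kids_cren t : kids (cren t) = map cren (kids t). Proof. by case: t. Qed.

Lemma filter_cren (p : nat -> bool) (s : seq cv) :
  [seq i <- map cren s | p (tag i)] = map cren [seq i <- s | p (tag i)].
Proof. by elim: s => //= x s ->; rewrite tag_cren; case: (p _). Qed.

Lemma flatten_cren (s : seq cv) (F F' : cv -> seq cv) :
  {in s, forall i, F' (cren i) = map cren (F i)} ->
  flatten (map F' (map cren s)) = map cren (flatten (map F s)).
Proof.
elim: s => //= x s IH H; rewrite map_cat H ?inE ?eqxx // IH // => i si.
by rewrite H // inE si orbT.
Qed.

Lemma ceval_cren e s : ceval e (fun x => cren (s x)) = cren (ceval e s).
Proof.
elim: e s => //=.
- by move=> e IH s; rewrite IH /op_text tag_cren lab_cren; case: ifP; rewrite /= ?r0.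
- move=> e1 IH1 e2 IH2 s; rewrite IH1 IH2 /op_elem !tag_cren lab_cren kids_cren.
  case: ifP => /= _; rewrite ?r0 //; congr Cv; rewrite -!map_comp.
  apply: eq_map => i /=; rewrite /tonode tag_cren; case: eqP => //= _.
  by rewrite lab_cren.
- move=> e IH s; rewrite IH /op_data tag_cren kids_cren.
  rewrite (filter_cren (fun g => g <= 1)).
  case: ifP => _ /=; rewrite r0 //; congr Cv; rewrite -!map_comp.
  by apply: eq_map => i /=; rewrite lab_cren.
- by move=> e IH s; rewrite IH /op_name tag_cren lab_cren; case: ifP; rewrite /= ?r0.
- move=> e IH s; rewrite IH /op_children tag_cren kids_cren all_map.
  rewrite (filter_cren (fun g => g == 2)).
  rewrite (eq_all (a2 := fun i => ~~ (tag i == 0))); last first.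
    by move=> i /=; rewrite tag_cren.
  case: ifP => _ /=; rewrite r0 //; congr Cv.
  by apply: flatten_cren => i _; rewrite kids_cren.
- by rewrite r0.
- by move=> e IH s; rewrite IH /op_single tag_cren; case: ifP; rewrite /= ?r0.
- move=> e1 IH1 e2 IH2 s; rewrite IH1 IH2 /op_comma !tag_cren !kids_cren.
  by case: ifP => _ /=; rewrite r0 // map_cat.
- move=> x k e1 IH1 e2 IH2 s; rewrite IH1 /op_for tag_cren kids_cren filter_cren.
  have E i : ceval e2 (upd (fun y => cren (s y)) x (cren i)) =
             cren (ceval e2 (upd s x i)).
    rewrite -IH2; congr (ceval e2); apply/funext => y.
    by rewrite /upd; case: eqP.
  rewrite all_map (eq_all (a2 := fun i => tag (ceval e2 (upd s x i)) == 3)).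
    case: ifP => _ /=; rewrite r0 //; congr Cv.
    by apply: flatten_cren => i _; rewrite E kids_cren.
  by move=> i /=; rewrite E tag_cren.
- move=> e1 H1 e2 H2 e3 H3 e4 H4 s; rewrite H1 H2 H3 H4 /op_if !tag_cren.
  rewrite !lab_cren (inj_eq r_inj); case: ifP => _; last by rewrite /= r0.
  by case: ifP.
Qed.

Lemma cntype_cren t v : cntype t (cren v) = cntype t v.
Proof.
elim/ntype_ind_foldr: t v => [|ts IH] v /=; rewrite tag_cren //.
rewrite kids_cren all_map; congr andb; apply: eq_all => m /=.
by elim: ts IH => //= t ts IH [-> /IH ->].
Qed.

Lemma citype_cren t v : citype t (cren v) = citype t v.
Proof.
by elim: t => /= [|t|t1 -> t2 -> //]; rewrite ?tag_cren // cntype_cren.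
Qed.

Lemma ctype_cren t v : ctype t (cren v) = ctype t v.
Proof.
elim: t => /= [t|t|t1 -> t2 -> //]; last exact: citype_cren.
rewrite tag_cren kids_cren all_map; congr andb; apply: eq_all => m /=.
exact: citype_cren.
Qed.

Lemma accept_cren t v : accept t (cren v) = accept t v.
Proof. by rewrite /accept tag_cren; case: t => // t; rewrite ctype_cren. Qed.

Lemma csize_cren t : csize (cren t) = csize t.
Proof.
elim: t => g a s IH /=; congr S; congr sumn; rewrite -map_comp.
exact/eq_in_map.
Qed.

End Renaming.

Fixpoint clabs (t : cv) : seq nat :=
  let: Cv _ a s := t in a :: flatten (map clabs s).

Lemma size_clabs t : size (clabs t) = csize t.
Proof.
elim: t => g a s IH /=; rewrite size_flatten /shape -map_comp; congr (sumn _).+1.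
exact/eq_in_map.
Qed.

Fixpoint cv_all (p : nat -> nat -> bool) (t : cv) : bool :=
  let: Cv g a s := t in p g a && all (cv_all p) s.

Lemma cv_allE p t : cv_all p t = p (tag t) (lab t) && all (cv_all p) (kids t).
Proof. by case: t. Qed.

Lemma cv_all_le p x y : le x y -> cv_all p y -> cv_all p x.
Proof.
elim: x y => g a s IH y /leP[/= -> -> H]; rewrite cv_allE => /andP[-> /allP h].
by apply/allP => u us; have [v /h hv uv] := H u us; apply: IH hv.
Qed.

Lemma cv_all_cren r n t : cv_all (fun g _ => g <= 3) t ->
  (forall a, a \in clabs t -> r a < n) ->
  cv_all (fun g a => (g <= 3) && (a < n)) (cren r t).
Proof.
elim: t => g a s IH /= /andP[-> /allP hs] H; rewrite H ?inE ?eqxx //=.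
apply/allP => _ /mapP[x xs ->]; apply: IH => //; first exact: hs.
by move=> b bx; apply: H; rewrite inE; apply/orP; right; apply/flatten_mapP; exists x.
Qed.

(** * Exhaustive enumeration of small inputs *)

Section Enumeration.

Variable n : nat.

Definition seqs (xs : seq cv) : seq (seq cv) :=
  iter n (fun L => [::] :: flatten [seq [seq x :: s | s <- L] | x <- xs]) [:: [::]].

(** [d] bounds the nesting, [n] the labels and the numbers of kids. Ill-formed trees are produced
    too and are discarded later by the type filter; tag 4 is omitted because inputs are defined. *)
Definition enumT (d : nat) : seq cv :=
  iter d (fun xs => flatten [seq flatten [seq [seq Cv g a s | s <- seqs xs]
                                         | a <- iota 0 n] | g <- iota 0 4]) [::].

Lemma mem_seqs xs s : size s <= n -> {subset s <= xs} -> s \in seqs xs.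
Proof.
rewrite /seqs; elim: n s => [|m IH] [|x s] //= sm H.
rewrite inE /=; apply/flatten_mapP; exists x; first by apply: H; rewrite inE eqxx.
apply/mapP; exists s => //; apply: IH => // y ys; apply: H.
by rewrite inE ys orbT.
Qed.

Lemma mem_enumT d t : csize t <= d -> csize t <= n ->
  cv_all (fun g a => (g <= 3) && (a < n)) t -> t \in enumT d.
Proof.
elim: d t => [|d IH] [g a s] // sd sn.
rewrite cv_allE => /andP[/andP[g4 an] /allP H].
rewrite /= in sd sn.
rewrite /enumT iterS -/(enumT d).
apply/flatten_mapP; exists g; first by rewrite mem_iota.
apply/flatten_mapP; exists a; first by rewrite mem_iota.
apply/mapP; exists s => //; apply: mem_seqs.
  by apply: leq_trans (size_leq_csize s) _; lia.
move=> x xs; have hx := csize_mem xs; apply: IH; last exact: H.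
  by apply: leq_trans hx _.
by apply: leq_trans hx _; apply: ltnW.
Qed.

End Enumeration.

(** Variables carry predicates instead of types, so that the specification can use [ctype] and the
    program its interpreter of type codes. *)
Fixpoint envs (xs : seq cv) (G : seq (nat * (cv -> bool))) : seq (nat -> cv) :=
  if G is (x, p) :: G' then
    flatten [seq [seq upd s x v | v <- filter p xs] | s <- envs xs G']
  else [:: fun _ => Cv 3 0 [::]].

Lemma all_envs_cons (P : (nat -> cv) -> bool) xs x p G :
  all P (envs xs ((x, p) :: G)) =
  all (fun s => all (fun v => P (upd s x v)) (filter p xs)) (envs xs G).
Proof.
rewrite /=; elim: (envs xs G) => //= s L IH.
by rewrite all_cat IH all_map.
Qed.

Lemma all_envsP (P : (nat -> cv) -> bool) xs G s :
  all P (envs xs G) ->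
  all (fun xp => xp.2 (s xp.1) && (s xp.1 \in xs)) G ->
  exists2 s', P s' & {in map fst G, s' =1 s}.
Proof.
elim: G P => [|[x p] G IH] P.
  by rewrite /= andbT => Ps _; exists (fun _ => Cv 3 0 [::]).
rewrite all_envs_cons => /IH{}IH /= /andP[/andP[psx sx] /IH[s' /allP Ps' ss']].
exists (upd s' x (s x)); first by apply: Ps'; rewrite mem_filter psx.
move=> y; rewrite inE /upd; case: eqP => [->//|_] /=; exact: ss'.
Qed.

Lemma all_envs (P : (nat -> cv) -> bool) xs G : uniq (map fst G) ->
  (forall s, all (fun xp => xp.2 (s xp.1)) G -> P s) -> all P (envs xs G).
Proof.
elim: G P => [|[x p] G IH] P; first by move=> _ H; rewrite /= H.
rewrite all_envs_cons /= => /andP[xG uG] H; apply: IH => // s sG.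
apply/allP => v; rewrite mem_filter => /andP[pv _]; apply: H.
rewrite /= /upd eqxx pv /=; elim: G xG sG {uG} => //= -[y q] G IH.
rewrite inE negb_or /= => /andP[xy xG] /andP[qy sG].
by rewrite eq_sym (negPf xy) qy IH.
Qed.

Lemma ceval_ext e s s' : {in FV e, s =1 s'} -> ceval e s = ceval e s'.
Proof.
elim: e s s' => //=.
- by move=> x s s' H; apply: H; rewrite inE.
- by move=> e IH s s' H; rewrite (IH s s').
- move=> e1 IH1 e2 IH2 s s' H; rewrite (IH1 s s') ?(IH2 s s') // => x xe;
  by apply: H; rewrite inE xe ?orbT.
- by move=> e IH s s' H; rewrite (IH s s').
- by move=> e IH s s' H; rewrite (IH s s').
- by move=> e IH s s' H; rewrite (IH s s').
- by move=> e IH s s' H; rewrite (IH s s').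
- move=> e1 IH1 e2 IH2 s s' H; rewrite (IH1 s s') ?(IH2 s s') // => x xe;
  by apply: H; rewrite inE xe ?orbT.
- move=> x k e1 IH1 e2 IH2 s s' H; rewrite (IH1 s s').
    congr op_for; apply/funext => i; apply: IH2 => y ye; rewrite /upd.
    by case: eqP => // /eqP yx; apply: H; rewrite !inE yx ye orbT.
  by move=> y ye; apply: H; rewrite inE ye.
- move=> e1 H1 e2 H2 e3 H3 e4 H4 s s' H.
  by rewrite (H1 s s') ?(H2 s s') ?(H3 s s') ?(H4 s s') // => x xe;
    apply: H; rewrite !inE xe ?orbT.
Qed.

(* Fixes 0 because 0 labels the sets. *)
Definition renum (l : seq nat) (a : nat) : nat :=
  let l' := 0 :: [seq x <- undup l | ~~ (x == 0)] in
  if a \in l' then index a l' else size l' + a.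

Lemma renum0 l : renum l 0 = 0. Proof. by []. Qed.

Lemma renum_inj l : injective (renum l).
Proof.
rewrite /renum; set l' := 0 :: _ => a b.
case: ifP => al; case: ifP => bl.
- by move=> e; rewrite -[a](nth_index 0 al) e nth_index.
- by move=> e; move: al; rewrite -index_mem e ltnNge leq_addr.
- by move=> e; move: bl; rewrite -index_mem -e ltnNge leq_addr.
- by move/addnI.
Qed.

Lemma renum_lt l a : a \in l -> renum l a < (size l).+1.
Proof.
move=> al; rewrite /renum; set l' := 0 :: _.
have al' : a \in l'.
  by rewrite inE mem_filter mem_undup al andbT; case: (a == 0).
rewrite al'; apply: leq_trans (_ : size l' <= _); first by rewrite index_mem.
rewrite /= ltnS size_filter; apply: leq_trans (count_size _ _) _.
exact: size_undup.
Qed.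

Definition typing (G : seq (nat * rxtype)) : seq (nat * (cv -> bool)) :=
  [seq (xt.1, ctype xt.2) | xt <- G].

(** With [K] the size bound for one value, the inputs for [G] carry at most [size G * K] labels. The
    extra [K], which is positive, makes room for label 0 and lets the same number bound the size of
    each value. *)
Definition cbound (e : expr) (G : seq (nat * rxtype)) (t : option rxtype) : nat :=
  (size G).+1 * bnd e (csz t).

Lemma bnd_gt0 e k : 0 < k -> 0 < bnd e k.
Proof.
elim: e k => //=.
- by move=> e IH k _; exact: IH.
- by move=> e1 IH1 e2 IH2 k _; rewrite addn_gt0 IH1.
- by move=> e IH k _; exact: IH.
- by move=> e IH k _; exact: IH.
- by move=> e IH k _; exact: IH.
- by move=> e IH k _; exact: IH.
- by move=> e1 IH1 e2 IH2 k _; rewrite addn_gt0 IH1.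
- by move=> e1 IH1 *; rewrite !addn_gt0 IH1.
Qed.

Theorem small_model e G t n :
  cbound e G t <= n ->
  {subset FV e <= map fst G} ->
  all (fun s => accept t (ceval e s)) (envs (enumT n n) (typing G)) ->
  forall s, all (fun xt => ctype xt.2 (s xt.1) &&
                           cv_all (fun g _ => g <= 3) (s xt.1)) G ->
    accept t (ceval e s).
Proof.
move=> en FVG allG s sG; apply/negPn/negP => /accept_witness[w [ws sw nw]].
move: en; rewrite /cbound; set K := bnd e (csz t); rewrite mulSn => en.
have [s0 [s0s s0K ws0]] := smallP ws.
have {}s0K x : csize (s0 x) <= K by apply: leq_trans (s0K x) (bnd_mono _ sw).
have {}nw : ~~ accept t (ceval e s0) by apply: contraNN nw; exact: accept_le_top.
pose l := flatten [seq clabs (s0 xt.1) | xt <- G].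
have sl : size l <= size G * K.
  rewrite /l; elim: (G) => //= xt G' IH.
  by rewrite size_cat mulSn size_clabs leq_add.
pose r := renum l; pose s1 x := cren r (s0 x).
have nw1 : ~~ accept t (ceval e s1).
  by rewrite (ceval_cren (@renum_inj l) (renum0 l)) accept_cren.
have K0 : 0 < K by apply: bnd_gt0; case: (t) => //= t'; exact: dsize_gt0.
(* The enumeration prescribes values on the variables of [G] only, so it yields some [s2] that
   agrees with [s1] there, which is all that [e] can see. *)
have [s2 h2 s21] : exists2 s2, accept t (ceval e s2) &
    {in map fst (typing G), s2 =1 s1}.
  apply: (all_envsP allG); rewrite all_map.
  have lG : all (fun xt => all (mem l) (clabs (s0 xt.1))) G.
    rewrite /l; elim: (G) => //= xt G' IH; apply/andP; split.
      by apply/allP => a; rewrite inE /= mem_cat => ->.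
    apply: sub_all IH => xt' /allP h; apply/allP => a /h.
    by rewrite !inE mem_cat orbC => ->.
  have sGl := conj sG lG; move/andP: sGl; rewrite -all_predI.
  apply: sub_all => xt /= /andP[/andP[ctx c4] /allP xl].
  have sKn : csize (s1 xt.1) <= n.
    by rewrite csize_cren; apply: leq_trans (s0K _) (leq_trans (leq_addr _ _) en).
  rewrite ctype_cren (ctype_le (s0s _) ctx) /=.
  apply: mem_enumT => //; apply: cv_all_cren; first exact: cv_all_le (s0s _) c4.
  move=> a /xl al; apply: leq_trans (renum_lt al) (leq_trans _ en).
  by rewrite -add1n leq_add.
have := h2; rewrite (@ceval_ext e s2 s1) ?(negPf nw1) // => x /FVG xG.
by apply: s21; rewrite /typing -map_comp.
Qed.

(** * Comparison with the semantics over an arbitrary set of atoms *)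

#[local] Arguments node_view : simpl never.
#[local] Arguments elem_node : simpl never.

Lemma imfset_seq (X Y : choiceType) (h : X -> Y) (s : seq X) :
  [fset h x | x in [fset y in s]]%fset = [fset y in map h s]%fset.
Proof.
apply/fsetP => u; rewrite !inE; apply/imfsetP/mapP => [[x]|[x xs ->]].
  by rewrite /= inE => xs ->; exists x.
by exists x => //; rewrite /= inE.
Qed.

Lemma eq_fset_map (X : Type) (Y : choiceType) (h1 h2 : X -> Y) (s : seq X) :
  h1 =1 h2 -> [fset y in map h1 s]%fset = [fset y in map h2 s]%fset.
Proof. by move=> /eq_map ->. Qed.

Lemma all_fset_seq (X : choiceType) (p : pred X) (s : seq X) :
  all p [fset y in s]%fset = all p s.
Proof.
apply/allP/allP => H x xs; apply: H; first by rewrite inE.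
by move: xs; rewrite inE.
Qed.

(** * Well-formed trees and their denotations *)

(** The kids of a data node, and those of an atom in [wf_item], are unconstrained. The type tests
    and the denotation ignore them too, so every typed tree is well-formed. *)
Fixpoint wf_node (t : cv) : bool :=
  let: Cv g _ s := t in (g == 1) || ((g == 2) && all wf_node s).

Definition wf_item (t : cv) : bool := (tag t == 0) || wf_node t.

Definition wf (t : cv) : bool :=
  wf_item t || ((tag t == 3) && all wf_item (kids t)).

Lemma cntype_wf t v : cntype t v -> wf_node v.
Proof.
elim/ntype_ind_foldr: t v => [|ts IH] [g a s] /=; first by move=> ->.
case/andP=> -> /allP H; rewrite orbC /=; apply/orP; left; apply/allP => m /H{H}.
by elim: ts IH => //= t ts IH [Ht /IH{}IH] /orP[/Ht|].
Qed.

Lemma citype_wf t v : citype t v -> wf_item v.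
Proof.
rewrite /wf_item; elim: t => /= [->//|t /cntype_wf ->|t1 IH1 t2 IH2].
  by rewrite orbT.
by case/orP.
Qed.

Lemma ctype_wf t v : ctype t v -> wf v.
Proof.
rewrite /wf; elim: t => /= [t|t /citype_wf ->//|t1 IH1 t2 IH2]; last by case/orP.
move=> /andP[-> /allP H]; apply/orP; right; apply/allP => u /H.
exact: citype_wf.
Qed.

Section Denotation.

Variables (A : choiceType) (f : nat -> A) (g : A -> nat).
Hypotheses (fK : cancel f g) (gK : cancel g f).

Fixpoint den_node (t : cv) : node A :=
  let: Cv g a s := t in
  if g == 2 then elem_node (f a) [fset m in map den_node s]%fset
  else data_node (f a).

Definition den_item (t : cv) : item A :=
  if tag t == 0 then IAtom (f (lab t)) else INode (den_node t).

Definition den_set (s : seq cv) : {fset item A} :=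
  [fset i in map den_item s]%fset.

Definition den (t : cv) : value A :=
  if tag t == 3 then VSet (den_set (kids t)) else VItem (den_item t).

Lemma mem_den_set i s : reflect (exists2 t, t \in s & i = den_item t)
  (i \in den_set s).
Proof. by rewrite /den_set !inE; exact: mapP. Qed.

Lemma in_ntypeE t (n : node A) :
  in_ntype t n =
  match t, node_view n with
  | Tdata, inl _ => true
  | Telem ts, inr (_, N) => all (fun m => has (fun t' => in_ntype t' m) ts) N
  | _, _ => false
  end.
Proof. by case: t. Qed.

Lemma node_view_den t : wf_node t ->
  node_view (den_node t) =
  if tag t == 2 then inr (f (lab t), [fset m in map den_node (kids t)]%fset)
  else inl (f (lab t)).
Proof.
by case: t => -[|[|[|k]]] a s // _; rewrite [den_node _]/= elem_nodeK.
Qed.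

Lemma in_ntype_den t v : wf_node v -> in_ntype t (den_node v) = cntype t v.
Proof.
elim/ntype_ind_foldr: t v => [|ts IH] v wv; rewrite in_ntypeE node_view_den //.
  by case: v wv => [[|[|[|k]]] a s].
case: v wv => [[|[|[|k]]] a s] //= /allP ws.
rewrite all_fset_seq all_map; apply: eq_in_all => m /ws wm /=.
by elim: ts IH => //= t ts IH [/(_ m wm) -> /IH ->].
Qed.

Lemma in_itype_den t v : wf_item v -> in_itype t (den_item v) = citype t v.
Proof.
rewrite /wf_item; elim: t => [|t|t1 IH1 t2 IH2] wv /=.
- by rewrite /den_item; case: eqP.
- rewrite /den_item; move: wv; case: eqP => /= [e _|_ wv].
    by case: (t) => [|ts] /=; rewrite e.
  exact: in_ntype_den.
- by rewrite IH1 ?IH2.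
Qed.

Lemma in_type_den t v : wf v -> in_type t (den v) = ctype t v.
Proof.
elim: t => [t|t|t1 IH1 t2 IH2] wv /=; last by rewrite IH1 ?IH2.
- rewrite /den; case: eqP => //= tv.
  rewrite all_fset_seq all_map; apply: eq_in_all => i iv /=.
  apply: in_itype_den; move: wv; rewrite /wf /wf_item tv /=.
  case/orP=> [|/allP/(_ i iv) //].
  by case: (v) tv => g' a s /= ->.
- rewrite /den; case: eqP => tv /=; last first.
    apply: in_itype_den; move: wv; rewrite /wf; case/orP=> // /andP[/eqP].
    by move/tv.
  have wn : ~~ wf_item v by rewrite /wf_item; case: (v) tv => g' a s /= ->.
  by apply/esym/negbTE; apply: contraNN wn; exact: citype_wf.
Qed.

(** * Agreement of evaluation on trees with the semantics *)

Definition res (r : cv) (o : option (value A)) : Prop :=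
  if tag r == 4 then o = None else wf r /\ o = Some (den r).

Lemma resP r o : res r o ->
  [\/ tag r = 4 /\ o = None,
      tag r = 0 /\ o = Some (VItem (IAtom (f (lab r)))),
      tag r = 1 /\ o = Some (VItem (INode (data_node (f (lab r))))) |
      (tag r = 2 /\ all wf_node (kids r) /\
         o = Some (VItem (INode (elem_node (f (lab r))
                                 [fset m in map den_node (kids r)]%fset)))) \/
      (tag r = 3 /\ all wf_item (kids r) /\ o = Some (VSet (den_set (kids r))))].
Proof.
case: r => [[|[|[|[|[|k]]]]] a s]; rewrite /res /=.
- by case=> _ ->; constructor 2.
- by case=> _ ->; constructor 3.
- rewrite /wf /wf_item /= orbF => -[w ->]; constructor 4; left.
  by split.
- by rewrite /wf /wf_item /= => -[w ->]; constructor 4; right.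
- by move=> ->; constructor 1.
- by case.
Qed.

Lemma res_text r o : res r o ->
  res (op_text r) (if o is Some (VItem (IAtom a))
                   then Some (VItem (INode (data_node a))) else None).
Proof.
rewrite /op_text; case/resP=> [[-> ->]|[-> ->]|[-> ->]|[[-> [_ ->]]|[-> [_ ->]]]] //=.
Qed.

Lemma res_name r o : res r o ->
  res (op_name r) (if o is Some (VItem (INode n)) then
                     if node_view n is inr (a, _)
                     then Some (VItem (IAtom a)) else None
                   else None).
Proof.
rewrite /op_name; case/resP=> [[-> ->]|[-> ->]|[-> ->]|[[-> [_ ->]]|[-> [_ ->]]]] //=.
Qed.

Lemma den_set1 r : den_set [:: r] = [fset den_item r]%fset.
Proof.
apply/fsetP => x; apply/mem_den_set/fset1P => [[t]|->].
  by rewrite inE => /eqP ->.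
by exists r; rewrite ?inE.
Qed.

Lemma res_single r o : res r o ->
  res (op_single r)
      (if o is Some (VItem i) then Some (VSet [fset i]%fset) else None).
Proof.
rewrite /op_single.
case/resP=> [[-> ->]|[t ->]|[t ->]|[[t [w ->]]|[-> [_ ->]]]] //=; rewrite t;
  rewrite /res /= /wf /wf_item /= /den /= den_set1 /den_item t /=.
- by [].
- by case: r t {o} => [k a s] /= ->.
- by case: r t w {o} => [k a s] /= -> ->.
Qed.

Lemma res_elem r1 o1 r2 o2 : res r1 o1 -> res r2 o2 ->
  res (op_elem r1 r2)
      (if (o1, o2) is (Some (VItem (IAtom a)), Some (VSet w))
       then Some (VItem (INode (elem_node a (content w)))) else None).
Proof.
rewrite /op_elem.
case/resP=> [[-> ->]|[-> ->]|[-> ->]|[[-> [_ ->]]|[-> [_ ->]]]] //=.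
case/resP=> [[-> ->]|[-> ->]|[-> ->]|[[-> [_ ->]]|[-> [w ->]]]] //=.
rewrite /res /= /wf /wf_item /= orbF; split.
  rewrite all_map; apply: sub_all w => i; rewrite /wf_item /tonode /=.
  by case: eqP.
rewrite /den /den_item /=; do 4 congr (_ _).
rewrite /content /den_set imfset_seq -!map_comp; apply: eq_fset_map => i /=.
rewrite /den_item /tonode.
by case: eqP.
Qed.

Lemma res_data r o : res r o ->
  res (op_data r) (if o is Some (VSet w) then Some (VSet (atomize w)) else None).
Proof.
rewrite /op_data.
case/resP=> [[-> ->]|[-> ->]|[-> ->]|[[-> [_ ->]]|[-> [w ->]]]] //=.
rewrite /res /= /wf /wf_item /=; split.
  by rewrite all_map; apply/allP.
rewrite /den /=; do 2 congr (_ _); apply/fsetP => x.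
rewrite /atomize inE mem_pmap; apply/mapP/mem_den_set.
  case=> i /mem_den_set[t ts ->]; rewrite /den_item.
  case: eqP => [t0 [->]|/eqP t0].
    exists (Cv 0 (lab t) [::]) => //; apply/mapP; exists t => //.
    by rewrite mem_filter t0.
  have := allP w t ts; rewrite /wf_item (negPf t0) /= => /node_view_den ->.
  case: eqP => // t2 [->]; exists (Cv 0 (lab t) [::]) => //.
  apply/mapP; exists t => //; rewrite mem_filter ts andbT.
  have := allP w t ts; rewrite /wf_item; move: t0 t2.
  by case: (t) => [[|[|[|k]]] a' s'].
case=> t' /mapP[t]; rewrite mem_filter => /andP[t1 ts] -> ->.
exists (den_item t); first by apply/mem_den_set; exists t.
rewrite /den_item [tag (Cv _ _ _)]/= eqxx; case: (eqVneq (tag t) 0) => // t0.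
have := allP w t ts; rewrite /wf_item (negPf t0) /= => /node_view_den ->.
by case: eqP t1 => // ->.
Qed.

Lemma has_Katom s : all wf_item s ->
  has (in_kind Katom) (den_set s) = ~~ all (fun i => ~~ (tag i == 0)) s.
Proof.
move=> w; rewrite -has_predC; apply/hasP/hasP.
  case=> x /mem_den_set[t ts ->]; rewrite /den_item; case: eqP => //= t0 _.
  by exists t => //=; rewrite t0.
case=> t ts /=; rewrite negbK => t0; exists (den_item t).
  by apply/mem_den_set; exists t.
by rewrite /den_item t0.
Qed.

Lemma res_children r o : res r o ->
  res (op_children r)
      (if o is Some (VSet w) then
         if has (in_kind Katom) w then None
         else Some (VSet (\bigcup_(i <- w) children_of i)%fset)
       else None).
Proof.
rewrite /op_children.
case/resP=> [[-> ->]|[-> ->]|[-> ->]|[[-> [_ ->]]|[-> [w ->]]]] //=.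
rewrite has_Katom //; case: ifP => //= an; rewrite /res /= /wf /=.
have wk t u : t \in kids r -> tag t = 2 -> u \in kids t -> wf_node u.
  move=> tr t2 ut; have := allP w t tr; rewrite /wf_item t2 /=.
  by case: (t) t2 ut => k a s /= -> us /allP; apply.
split.
  apply/allP => u /flatten_mapP[t]; rewrite mem_filter => /andP[/eqP t2 tr] ut.
  by rewrite /wf_item (wk t) ?orbT.
rewrite /den /=; do 2 congr (_ _); apply/fsetP => x.
apply/bigfcupP/mem_den_set.
  case=> i; rewrite andbT => /mem_den_set[t tr ->]; rewrite /den_item.
  have := allP an t tr; case: eqP => // t0 _ /=.
  have wt : wf_node t by have := allP w t tr; rewrite /wf_item; case: eqP.
  rewrite node_view_den //; case: eqP => //= t2.
  case/imfsetP=> m /=; rewrite inE => /mapP[u ut ->] ->.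
  exists u; first by apply/flatten_mapP; exists t; rewrite // mem_filter t2.
  have := wk _ _ tr t2 ut.
  by rewrite /den_item; case: eqP => //; case: (u) => k a s /= ->.
case=> u /flatten_mapP[t]; rewrite mem_filter => /andP[/eqP t2 tr] ut ->.
exists (den_item t); first by rewrite andbT; apply/mem_den_set; exists t.
have wt : wf_node t by have := allP w t tr; rewrite /wf_item t2.
rewrite /den_item t2 /= node_view_den // t2 /=.
have wu := wk _ _ tr t2 ut.
have -> : (tag u == 0) = false by case: (u) wu => [[|k] a s].
by apply/imfsetP; exists (den_node u) => //=; rewrite inE; exact: map_f.
Qed.

Lemma res_comma r1 o1 r2 o2 : res r1 o1 -> res r2 o2 ->
  res (op_comma r1 r2)
      (if (o1, o2) is (Some (VSet w1), Some (VSet w2))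
       then Some (VSet (w1 `|` w2)%fset) else None).
Proof.
rewrite /op_comma.
case/resP=> [[-> ->]|[-> ->]|[-> ->]|[[-> [_ ->]]|[-> [w1 ->]]]] //=;
case/resP=> [[-> ->]|[-> ->]|[-> ->]|[[-> [_ ->]]|[-> [w2 ->]]]] //=.
rewrite /res /= /wf /= all_cat w1 w2; split=> //.
rewrite /den /=; do 2 congr (_ _); apply/fsetP => x.
by rewrite /den_set !inE map_cat mem_cat.
Qed.

(** The one construct that compares atoms, and so the place where injectivity of [f] enters. *)
Lemma res_if r1 o1 r2 o2 r3 o3 r4 o4 :
  res r1 o1 -> res r2 o2 -> res r3 o3 -> res r4 o4 ->
  res (op_if r1 r2 r3 r4)
      (if (o1, o2) is (Some (VItem (IAtom a)), Some (VItem (IAtom b)))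
       then if a == b then o3 else o4 else None).
Proof.
rewrite /op_if.
case/resP=> [[-> ->]|[-> ->]|[-> ->]|[[-> [_ ->]]|[-> [w1 ->]]]] //=;
case/resP=> [[-> ->]|[-> ->]|[-> ->]|[[-> [_ ->]]|[-> [w2 ->]]]] //=.
by move=> h3 h4; rewrite (inj_eq (can_inj fK)); case: ifP.
Qed.

Lemma in_kind_den k i : wf_item i -> in_kind k (den_item i) = ckind k (tag i).
Proof.
rewrite /wf_item => wi; elim: k => /= [|||k1 -> k2 ->] //.
- by rewrite /den_item; case: eqP.
- rewrite /den_item; move: wi; case: eqP => /= [-> //|t0 wi].
  by rewrite node_view_den //; case: (i) t0 wi => [[|[|[|k]]] a s].
- rewrite /den_item; move: wi; case: eqP => /= [-> //|t0 wi].
  by rewrite node_view_den //; case: (i) t0 wi => [[|[|[|k]]] a s].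
Qed.

Definition results_union (s : seq (option (value A))) : {fset item A} :=
  (\bigcup_(r <- s) (if r is Some (VSet w) then w else fset0))%fset.

(** Replaces the ordered fold by a test on all results and a union, neither of which depends on
    order or repetition. *)
Lemma union_resultsE s :
  union_results s =
  if all (fun r => if r is Some (VSet _) then true else false) s
  then Some (VSet (results_union s)) else None.
Proof.
rewrite /results_union; elim: s => [|r s IH]; first by rewrite /= big_nil.
rewrite big_cons; move: IH; rewrite /union_results /=.
case: foldr => [u|]; case: all => //= IH; case: r => [[i|w]|] //=.
by case: IH => ->.
Qed.

Lemma res_for p (q : item A -> bool) r o F G : res r o ->
  (forall i, wf_item i -> q (den_item i) = p (tag i)) ->
  (forall i, wf_item i -> res (F i) (G (den_item i))) ->
  res (op_for p r F)
      (if o is Some (VSet w) then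
         union_results [seq G i | i <- enum_fset w & q i]
       else None).
Proof.
move=> ro qp FG; move: ro; rewrite /op_for.
case/resP=> [[-> ->]|[-> ->]|[-> ->]|[[-> [_ ->]]|[-> [w ->]]]] //=.
rewrite union_resultsE; set s := [seq i <- kids r | p (tag i)].
have sP i : i \in s -> wf_item i /\ i \in kids r.
  by rewrite mem_filter => /andP[_ ir]; split=> //; exact: allP w i ir.
(* The enumeration of the denoted set has another order and no repetitions, so the two loops are
   compared by membership alone. *)
have memP x : x \in [seq i <- enum_fset (den_set (kids r)) | q i] <->
    exists2 i, i \in s & x = den_item i.
  rewrite mem_filter; split.
    case/andP=> qx /mem_den_set[i ir ex]; exists i => //.
    by rewrite mem_filter ir andbT -qp -?ex //; exact: allP w i ir.
  case=> i iS ->; have [wi ir] := sP i iS; rewrite qp //.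
  move: iS; rewrite mem_filter => /andP[-> _] /=.
  by apply/mem_den_set; exists i.
have allE : all (fun r => if r is Some (VSet _) then true else false)
    [seq G i | i <- [seq i <- enum_fset (den_set (kids r)) | q i]] =
    all (fun i => tag (F i) == 3) s.
  rewrite all_map; apply/allP/allP => H i.
    move=> iS; have [wi ir] := sP i iS.
    have /memP/H /= : exists2 j, j \in s & den_item i = den_item j by exists i.
    have := FG i wi.
    by case/resP=> [[-> ->]|[-> ->]|[-> ->]|[[-> [_ ->]]|[-> [_ ->]]]].
  case/memP=> j jS -> /=; have [wj _] := sP j jS; have := FG j wj.
  have := H j jS.
  by case: eqP => // t3 _ /resP; rewrite t3; case=> [[]|[]|[]|[[]|[_ [_ ->]]]].
rewrite allE; case: ifP => // aF; rewrite /res /= /wf /=.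
have rF i : i \in s -> all wf_item (kids (F i)) /\
    G (den_item i) = Some (VSet (den_set (kids (F i)))).
  move=> iS; have [wi _] := sP i iS; have := FG i wi; have := allP aF i iS.
  by case: eqP => // t3 _ /resP; rewrite t3; case=> [[]|[]|[]|[[]|[_ ]]].
split.
  by apply/allP => u /flatten_mapP[i /rF[/allP h _]]; exact: h.
rewrite /den /=; do 2 congr (_ _); apply/fsetP => x.
rewrite /results_union big_map; apply/bigfcupP/mem_den_set.
  case=> z; rewrite andbT => /memP[i iS ->].
  have [_ ->] := rF i iS; case/mem_den_set=> u uF ->; exists u => //.
  by apply/flatten_mapP; exists i.
case=> u /flatten_mapP[i iS uF ->].
have [_ eG] := rF i iS; exists (den_item i).
  by rewrite andbT; apply/memP; exists i.
by rewrite eG; apply/mem_den_set; exists u.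
Qed.

Definition env_den (X : {fset nat}) (s : nat -> cv) (st : env A) : Prop :=
  forall x, x \in X -> (st.[? x])%fmap = Some (den (s x)) /\ wf (s x).

Lemma env_den_sub (X Y : {fset nat}) s st :
  {subset X <= Y} -> env_den Y s st -> env_den X s st.
Proof. by move=> XY H x /XY; exact: H. Qed.

Lemma eval_den e s st : env_den (FV e) s st -> res (ceval e s) (eval e st).
Proof.
elim: e s st.
- move=> x s st H; have [|e w] := H x; first by rewrite /= inE.
  rewrite /= e /res; case: eqP => // t4.
  by move: w; rewrite /wf /wf_item; case: (s x) t4 => g' a' s' /= ->.
- by move=> e IH s st /IH; exact: res_text.
- move=> e1 IH1 e2 IH2 s st H /=; apply: res_elem.
    by apply: IH1; apply: env_den_sub H => x xe; rewrite /= inE xe.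
  by apply: IH2; apply: env_den_sub H => x xe; rewrite /= inE xe orbT.
- by move=> e IH s st /IH; exact: res_data.
- by move=> e IH s st /IH; exact: res_name.
- by move=> e IH s st /IH; exact: res_children.
- move=> s st _; rewrite /res /= /den /=; split=> //; do 2 congr (_ _).
  apply/fsetP => x; rewrite in_fset0; apply/esym/negbTE/negP.
  by case/mem_den_set.
- by move=> e IH s st /IH; exact: res_single.
- move=> e1 IH1 e2 IH2 s st H /=; apply: res_comma.
    by apply: IH1; apply: env_den_sub H => x xe; rewrite /= inE xe.
  by apply: IH2; apply: env_den_sub H => x xe; rewrite /= inE xe orbT.
- move=> x k e1 IH1 e2 IH2 s st H /=; apply: res_for.
  + by apply: IH1; apply: env_den_sub H => y ye; rewrite /= inE ye.
  + by move=> i; exact: in_kind_den.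
  + move=> i wi; apply: IH2 => y ye; rewrite fnd_set /upd.
    case: eqP => [_|/eqP yx].
      rewrite /wf wi /den; case: eqP => // t3; split=> //.
      by move: wi; rewrite /wf_item; case: (i) t3 => g' a' s' /= ->.
    by apply: H; rewrite /= !inE yx ye orbT.
- move=> e1 H1 e2 H2 e3 H3 e4 H4 s st H /=.
  by apply: res_if; [apply: H1|apply: H2|apply: H3|apply: H4];
    apply: env_den_sub H => x xe; rewrite /= !inE xe ?orbT.
Qed.

(** * Correctness of the search over the given atoms *)

(** Well-formedness does not control the ignored kids of atoms and data nodes, whereas the
    enumeration produces tags up to 3 only. Representatives of values are therefore chosen with this
    property. *)
Definition tags3 : cv -> bool := cv_all (fun k _ => k <= 3).

Lemma den_node_surj (n : node A) :
  exists t, [/\ wf_node t, tags3 t & den_node t = n].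
Proof.
elim/(@node_ind A): n => [a|a N IH].
  by exists (Cv 1 (g a) [::]); split=> //=; rewrite gK.
have /choice[F HF] : forall m, exists t, m \in N ->
    [/\ wf_node t, tags3 t & den_node t = m].
  by move=> m; case: (boolP (m \in N)) => [/IH[t]|_]; [exists t|exists Err].
exists (Cv 2 (g a) (map F N)); split=> /=.
- by apply/allP => _ /mapP[m mN ->]; have [] := HF m mN.
- by apply/allP => _ /mapP[m mN ->]; have [] := HF m mN.
- rewrite gK; congr elem_node; apply/fsetP => m; rewrite !inE -map_comp.
  apply/mapP/idP => [[m' m'N ->] /=|mN]; first by have [_ _ ->] := HF m' m'N.
  by exists m => //=; have [_ _ ->] := HF m mN.
Qed.

Lemma den_item_surj (i : item A) :
  exists t, [/\ wf_item t, tags3 t & den_item t = i].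
Proof.
case: i => [a|n]; first by exists (Cv 0 (g a) [::]); rewrite /den_item /= gK.
have [t [w t3 e]] := den_node_surj n; exists t; rewrite /wf_item w orbT.
by split=> //; rewrite /den_item e; case: eqP w => //; case: (t) => k a s /= ->.
Qed.

Lemma den_surj (v : value A) : exists t, [/\ wf t, tags3 t & den t = v].
Proof.
case: v => [i|N].
  have [t [w t3 e]] := den_item_surj i; exists t; rewrite /wf w; split=> //.
  rewrite /den e; case: eqP w => //; rewrite /wf_item.
  by case: (t) => k a s /= ->.
have /choice[F HF] := den_item_surj.
exists (Cv 3 0 (map F N)); rewrite /wf /=; split.
- by apply/allP => _ /mapP[m mN ->]; have [] := HF m.
- by apply/allP => _ /mapP[m mN ->]; have [] := HF m.
- rewrite /den /=; congr VSet; apply/fsetP => m.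
  apply/mem_den_set/idP => [[t /mapP[m' m'N ->] ->]|mN].
    by have [_ _ ->] := HF m'.
  by exists (F m); [exact: map_f|have [_ _ ->] := HF m].
Qed.

Lemma accept_den t r o : res r o ->
  (exists2 v, o = Some v & (if t is Some t' then in_type t' v else true))
  <-> accept t r.
Proof.
rewrite /res /accept; case: eqP => [_ ->|_ [w ->]] /=; first by split=> // -[].
case: t => [t|]; last by split=> // _; exists (den r).
rewrite -(in_type_den t w); split=> [[v [<-]]|h] //.
by exists (den r).
Qed.

Lemma all_In (X : Type) (p : pred X) (s : seq X) :
  all p s <-> (forall x, List.In x s -> p x).
Proof.
elim: s => //= x s IH; split=> [/andP[px /IH H] y [<-//|]|H]; first exact: H.
by apply/andP; split; [apply: H; left|apply/IH => y ys; apply: H; right].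
Qed.

Lemma env_den_exists (st : env A) : exists s, forall x,
  [/\ wf (s x), tags3 (s x) & forall v, (st.[? x])%fmap = Some v -> den (s x) = v].
Proof.
suff /choice[s sP] : forall x : nat, exists t, [/\ wf t, tags3 t &
    forall v, (st.[? x])%fmap = Some v -> den t = v] by exists s.
move=> x; case E : (st.[? x])%fmap => [v|]; last by exists (Cv 3 0 [::]).
by have [t [w t3 e]] := den_surj v; exists t; split=> // v' [<-].
Qed.

(** From left to right, an environment over [A] is pulled back to trees by surjectivity of [den] and
    handed to [small_model]. Conversely, every enumerated environment denotes one that satisfies
    [G]. *)
Theorem check_envs e (G : tassign) (Gs : seq (nat * rxtype)) t n :
  (forall x u, (G.[? x])%fmap = Some u <-> List.In (x, u) Gs) ->
  uniq (map fst Gs) -> domf G = FV e -> cbound e Gs t <= n ->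
  all (fun s => accept t (ceval e s)) (envs (enumT n n) (typing Gs)) <->
  (forall st : env A, env_in st G ->
     exists2 v, eval e st = Some v & (if t is Some t' then in_type t' v else true)).
Proof.
move=> GGs uG GFV en; split=> [allG st [domst stG]|H].
  have [s sP] := env_den_exists st.
  have stP x : x \in domf G -> (st.[? x])%fmap = Some (den (s x)).
    rewrite -domst => xst; have [_ _ sx] := sP x.
    by rewrite (sx _ (in_fnd xst)) in_fnd.
  have sden : env_den (FV e) s st.
    by move=> x; rewrite -GFV => xG; split; [exact: stP|have [] := sP x].
  apply/(accept_den _ (eval_den sden)); apply: small_model en _ allG _ _.
    move=> x; rewrite -GFV => xG.
    have /GGs : (G.[? x])%fmap = Some (G.[xG])%fmap by rewrite in_fnd.
    elim: (Gs) => //= -[y u] Gs' IH [[-> _]|/IH]; rewrite inE ?eqxx //= => ->.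
    by rewrite orbT.
  apply/all_In => -[x u] /GGs Gx /=; have [w t3 _] := sP x.
  rewrite -/tags3 t3 andbT -in_type_den //; apply: stG (Gx); apply: stP.
  by rewrite -fndSome Gx.
apply: all_envs; first by rewrite /typing -map_comp.
move=> s; rewrite all_map => /all_In sG.
pose st : env A := [fmap x : domf G => den (s (val x))]%fmap.
have stP x : x \in domf G -> (st.[? x])%fmap = Some (den (s x)).
  by move=> xG; rewrite in_fnd ffunE.
have ctG x u : (G.[? x])%fmap = Some u -> ctype u (s x).
  by move/GGs/sG.
have wG x : x \in domf G -> wf (s x).
  move=> xG; have /ctG/ctype_wf // : (G.[? x])%fmap = Some (G.[xG])%fmap.
  by rewrite in_fnd.
have sden : env_den (FV e) s st.
  by move=> x; rewrite -GFV => xG; split; [exact: stP|exact: wG].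
apply/(accept_den _ (eval_den sden)); apply: H; split=> // x v u stx Gx.
have xG : x \in domf G by rewrite -fndSome Gx.
by move: stx; rewrite stP // => -[<-]; rewrite in_type_den ?wG //; exact: ctG.
Qed.

End Denotation.

(** * The decision program *)

Fixpoint cvcode (t : cv) : dtree :=
  let: Cv g a s := t in Dcons (dnat g) (Dcons (dnat a) (dseq (map cvcode s))).

(** Representing a tree by its code lets constructor and selectors be borrowed from [dtree]. *)
Program Instance enc_cv : enc cv := {| rel t l := l = lenc (cvcode t) |}.
Next Obligation. by move=> t l ->; exact: lval_lenc. Qed.

Lemma rel_seq_cv (s : seq cv) (l : lterm) :
  rel s l <-> l = lenc (dseq (map cvcode s)).
Proof.
elim: s l => [|t s IH] l //=; split=> [[u [v [-> -> /IH ->]]] //|->].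
by exists (lenc (cvcode t)), (lenc (dseq (map cvcode s))); split=> //; exact/IH.
Qed.

Lemma real_cvcode : Real cvcode.
Proof. exact: real_coerce. Qed.

Definition cvcodes (s : seq cv) : dtree := dseq (map cvcode s).

Lemma real_cvcodes : Real cvcodes.
Proof. by apply: real_coerce => s l /rel_seq_cv. Qed.

#[export] Hint Resolve real_cvcode real_cvcodes : real.

Definition dhd (d : dtree) : dtree := drec Dnil (fun a _ _ _ => a) d.
Definition dtl (d : dtree) : dtree := drec Dnil (fun _ b _ _ => b) d.

Lemma real_dhd : Real dhd. Proof. by rewrite /dhd; creal. Qed.
Lemma real_dtl : Real dtl. Proof. by rewrite /dtl; creal. Qed.

#[export] Hint Resolve real_dhd real_dtl : real.

Lemma real_Cv : Real Cv.
Proof.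
have [t rt] : Real (fun g a s => Dcons (dnat g) (Dcons (dnat a) (cvcodes s))).
  by creal.
by exists t.
Qed.

Lemma real_tag : Real tag.
Proof.
suff -> : tag = fun t => dton (dhd (cvcode t)) by creal.
by apply/funext => -[g a s]; rewrite /= dtonK.
Qed.

Lemma real_lab : Real lab.
Proof.
suff -> : lab = fun t => dton (dhd (dtl (cvcode t))) by creal.
by apply/funext => -[g a s]; rewrite /= dtonK.
Qed.

Lemma real_kids : Real kids.
Proof.
have [r [vr Hr]] : Real (fun t => dtl (dtl (cvcode t))) by creal.
exists r; split=> // -[g a s] l /Hr[v ev rv]; exists v => //.
exact/rel_seq_cv.
Qed.

#[export] Hint Resolve real_Cv real_tag real_lab real_kids : real.

Lemma real_Err : Real Err.
Proof. by rewrite /Err; creal. Qed.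

Lemma real_upd : Real upd.
Proof.
change (Real (fun (s : nat -> cv) x v y => ifb (eqn y x) v (s y))); creal.
Qed.

#[export] Hint Resolve real_Err real_upd : real.

Lemma real_tonode : Real tonode.
Proof.
change (Real (fun i => ifb (eqn (tag i) 0) (Cv 1 (lab i) [::]) i)); creal.
Qed.

#[export] Hint Resolve real_tonode : real.

Lemma real_op_text : Real op_text.
Proof.
change (Real (fun v => ifb (eqn (tag v) 0) (Cv 1 (lab v) [::]) Err)); creal.
Qed.

Lemma real_op_elem : Real op_elem.
Proof.
change (Real (fun v w => ifb (andb (eqn (tag v) 0) (eqn (tag w) 3))
  (Cv 2 (lab v) (map tonode (kids w))) Err)); creal.
Qed.

Lemma real_op_data : Real op_data.
Proof.
change (Real (fun w => ifb (eqn (tag w) 3)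
  (Cv 3 0 (map (fun i => Cv 0 (lab i) [::]) (filter (fun i => leq (tag i) 1) (kids w))))
  Err)); creal.
Qed.

Lemma real_op_name : Real op_name.
Proof.
change (Real (fun v => ifb (eqn (tag v) 2) (Cv 0 (lab v) [::]) Err)); creal.
Qed.

Lemma real_op_children : Real op_children.
Proof.
change (Real (fun w =>
  ifb (andb (eqn (tag w) 3) (all (fun i => negb (eqn (tag i) 0)) (kids w)))
    (Cv 3 0 (flatten (map kids (filter (fun i => eqn (tag i) 2) (kids w)))))
    Err)); creal.
Qed.

Lemma real_op_single : Real op_single.
Proof.
change (Real (fun v => ifb (leq (tag v) 2) (Cv 3 0 (cons v [::])) Err)); creal.
Qed.

Lemma real_op_comma : Real op_comma.
Proof.
change (Real (fun v w => ifb (andb (eqn (tag v) 3) (eqn (tag w) 3))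
  (Cv 3 0 (cat (kids v) (kids w))) Err)); creal.
Qed.

Lemma real_op_for : Real op_for.
Proof.
change (Real (fun p w F =>
  ifb (andb (eqn (tag w) 3)
        (all (fun i => eqn (tag (F i)) 3) (filter (fun i => p (tag i)) (kids w))))
    (Cv 3 0 (flatten (map (fun i => kids (F i))
                         (filter (fun i => p (tag i)) (kids w)))))
    Err)); creal.
Qed.

Lemma real_op_if : Real op_if.
Proof.
change (Real (fun v1 v2 v3 v4 =>
  ifb (andb (eqn (tag v1) 0) (eqn (tag v2) 0))
    (ifb (eqn (lab v1) (lab v2)) v3 v4) Err)); creal.
Qed.

#[export] Hint Resolve real_op_text real_op_elem real_op_data real_op_name
  real_op_children real_op_single real_op_comma real_op_for real_op_if : real.

(** * Interpreters for the codes of instances *)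

(** Arguments of another sort, such as the variable and the kind in a loop, must be read as codes:
    the value that the same fold assigns to them is meaningless. *)
Definition arg_tree (M : Type) (m0 : M) (l : seq (dtree * M)) (i : nat) : dtree :=
  (nth (Dnil, m0) l i).1.
Definition arg_sem (M : Type) (m0 : M) (l : seq (dtree * M)) (i : nat) : M :=
  (nth (Dnil, m0) l i).2.

Lemma real_arg_tree (M : Type) (EM : enc M) : Real (@arg_tree M).
Proof. by rewrite /arg_tree; creal. Qed.

Lemma real_arg_sem (M : Type) (EM : enc M) : Real (@arg_sem M).
Proof. by rewrite /arg_sem; creal. Qed.

#[export] Hint Resolve real_arg_tree real_arg_sem : real.

(** Case distinction on the constructor is a lookup in a list indexed by tags. The entries are
    functions, so only the selected one is applied. *)
Definition pkind : dtree -> nat -> bool :=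
  rfold (fun _ => false) (fun k l =>
    nth (fun _ => false)
      [:: (fun g => eqn g 0); (fun g => eqn g 1); (fun g => eqn g 2);
          (fun g => orb (arg_sem (fun _ => false) l 0 g) (arg_sem (fun _ => false) l 1 g))]
      k).

Lemma real_pkind : Real pkind.
Proof. by rewrite /pkind; creal. Qed.

Lemma pkindE k : pkind (dkind k) = ckind k.
Proof.
apply/funext => g; elim: k => /= [|||k1 <- k2 <-];
  by rewrite /pkind ?[dkind (Kunion _ _)]/= rfold_dnode.
Qed.

Definition pntype : dtree -> cv -> bool :=
  rfold (fun _ => false) (fun k l =>
    nth (fun _ => false)
      [:: (fun v => eqn (tag v) 1);
          (fun v => andb (eqn (tag v) 2)
             (all (fun m => has (fun q => snd q m) l) (kids v)))]
      k).

Lemma real_pntype : Real pntype.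
Proof. by rewrite /pntype; creal. Qed.

Lemma pntypeE t : pntype (dntype t) = cntype t.
Proof.
elim/ntype_ind_foldr: t => [|ts IH]; apply/funext => v;
  rewrite /pntype [dntype _]/= rfold_dnode //= -map_comp.
congr andb; apply: eq_all => m; rewrite has_map.
by elim: ts IH => //= t ts IH [<- /IH ->].
Qed.

#[export] Hint Resolve real_pkind real_pntype : real.

Definition pitype : dtree -> cv -> bool :=
  rfold (fun _ => false) (fun k l =>
    nth (fun _ => false)
      [:: (fun v => eqn (tag v) 0);
          (fun v => pntype (arg_tree (fun _ => false) l 0) v);
          (fun v => orb (arg_sem (fun _ => false) l 0 v) (arg_sem (fun _ => false) l 1 v))]
      k).

Lemma real_pitype : Real pitype.
Proof. by rewrite /pitype; creal. Qed.

Lemma pitypeE t : pitype (ditype t) = citype t.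
Proof.
apply/funext => v; elim: t => [|t|t1 IH1 t2 IH2];
  rewrite /pitype [ditype _]/= rfold_dnode //=.
  by rewrite pntypeE.
by rewrite -IH1 -IH2.
Qed.

#[export] Hint Resolve real_pitype : real.

Definition ptype : dtree -> cv -> bool :=
  rfold (fun _ => false) (fun k l =>
    nth (fun _ => false)
      [:: (fun v => andb (eqn (tag v) 3)
             (all (pitype (arg_tree (fun _ => false) l 0)) (kids v)));
          (fun v => pitype (arg_tree (fun _ => false) l 0) v);
          (fun v => orb (arg_sem (fun _ => false) l 0 v) (arg_sem (fun _ => false) l 1 v))]
      k).

Lemma real_ptype : Real ptype.
Proof. by rewrite /ptype; creal. Qed.

Lemma ptypeE t : ptype (dtype t) = ctype t.
Proof.
apply/funext => v; elim: t => [t|t|t1 IH1 t2 IH2];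
  rewrite /ptype [dtype _]/= rfold_dnode //=.
- by rewrite /arg_tree /= pitypeE.
- by rewrite /arg_tree /= pitypeE.
- by rewrite -IH1 -IH2.
Qed.

Definition pexpr : dtree -> (nat -> cv) -> cv :=
  rfold (fun _ => Err) (fun k l =>
    nth (fun _ => Err)
      [:: (fun s => s (dton (arg_tree (fun _ => Err) l 0)));
          (fun s => op_text (arg_sem (fun _ => Err) l 0 s));
          (fun s => op_elem (arg_sem (fun _ => Err) l 0 s) (arg_sem (fun _ => Err) l 1 s));
          (fun s => op_data (arg_sem (fun _ => Err) l 0 s));
          (fun s => op_name (arg_sem (fun _ => Err) l 0 s));
          (fun s => op_children (arg_sem (fun _ => Err) l 0 s));
          (fun s => Cv 3 0 [::]);
          (fun s => op_single (arg_sem (fun _ => Err) l 0 s));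
          (fun s => op_comma (arg_sem (fun _ => Err) l 0 s) (arg_sem (fun _ => Err) l 1 s));
          (fun s => op_for (pkind (arg_tree (fun _ => Err) l 1))
             (arg_sem (fun _ => Err) l 2 s)
             (fun i => arg_sem (fun _ => Err) l 3
                         (upd s (dton (arg_tree (fun _ => Err) l 0)) i)));
          (fun s => op_if (arg_sem (fun _ => Err) l 0 s) (arg_sem (fun _ => Err) l 1 s)
             (arg_sem (fun _ => Err) l 2 s) (arg_sem (fun _ => Err) l 3 s))]
      k).

Lemma real_pexpr : Real pexpr.
Proof. by rewrite /pexpr; creal. Qed.

Lemma pexprE e : pexpr (dexpr e) = ceval e.
Proof.
elim: e => [x|e IH|e1 IH1 e2 IH2|e IH|e IH|e IH||e IH|e1 IH1 e2 IH2
           |x k e1 IH1 e2 IH2|e1 IH1 e2 IH2 e3 IH3 e4 IH4];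
  apply/funext => s; rewrite /pexpr [dexpr _]/= rfold_dnode /= /arg_sem /arg_tree /= -/pexpr
    ?IH ?IH1 ?IH2 ?IH3 ?IH4 //.
- by rewrite dtonK.
- by rewrite pkindE dtonK.
Qed.

(** Apart from variables, the empty sequence and loops, all constructors take expressions only and
    obey the same recurrence, so a single sum over the arguments covers them. *)
Definition pbnd : dtree -> nat -> nat :=
  rfold S (fun k l =>
    ifb (eqn k 9)
      (fun c => S (muln c (addn (arg_sem S l 2 (S (arg_sem S l 3 (S c))))
                                (arg_sem S l 3 (S c)))))
      (ifb (orb (eqn k 0) (eqn k 6)) S
         (fun c => sumn (map (fun q => snd q (S (addn c c))) l)))).

Lemma real_pbnd : Real pbnd.
Proof. by rewrite /pbnd; creal. Qed.

Lemma pbndE e : pbnd (dexpr e) = bnd e.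
Proof.
elim: e => [x|e IH|e1 IH1 e2 IH2|e IH|e IH|e IH||e IH|e1 IH1 e2 IH2
           |x k e1 IH1 e2 IH2|e1 IH1 e2 IH2 e3 IH3 e4 IH4];
  apply/funext => c; rewrite /pbnd [dexpr _]/= rfold_dnode /= /arg_sem /= -/pbnd
    ?IH ?IH1 ?IH2 ?IH3 ?IH4 ?addnn ?addn0 ?addnA //.
Qed.

Lemma real_dsize : Real dsize.
Proof.
suff -> : dsize = fun d => drec 1 (fun _ _ m n => S (addn m n)) d by creal.
by apply/funext; elim=> //= a -> b ->.
Qed.

Lemma real_seqs : Real seqs.
Proof.
change (Real (fun n xs => (fun n f (x : seq (seq cv)) => iter n f x) n
  (fun L => cons [::] (flatten (map (fun x => map (cons x) L) xs)))
  (cons [::] [::]))); creal.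
Qed.

#[export] Hint Resolve real_ptype real_pexpr real_pbnd real_dsize real_seqs : real.

Lemma real_enumT : Real enumT.
Proof.
change (Real (fun n d => (fun n f (x : seq cv) => iter n f x) d
  (fun xs => flatten (map (fun g => flatten (map (fun a =>
     map (fun s => Cv g a s) (seqs n xs)) (iota 0 n))) (iota 0 4))) [::])); creal.
Qed.

Lemma real_envs : Real envs.
Proof.
suff -> : envs = fun xs G => foldr (fun xp r =>
    flatten (map (fun s => map (fun v => upd s (fst xp) v)
                               (filter (snd xp) xs)) r))
    (cons (fun _ => Cv 3 0 [::]) [::]) G by creal.
by apply/funext => xs; apply/funext; elim=> //= -[x p] G ->.
Qed.

#[export] Hint Resolve real_enumT real_envs : real.

(** * The checking programs and their correctness *)

Definition ptyping (d : dtree) : seq (nat * (cv -> bool)) :=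
  map (fun b => pair (dton (dhd b)) (ptype (dtl b))) (dlist d).

Definition pcbound (c : nat) (e G : dtree) : nat :=
  muln (S (foldr (fun _ r => S r) 0 (dlist G))) (pbnd e c).

(** The bound is a parameter so that its two uses share one computed value. *)
Definition pcheck_bounded (n : nat) (q : cv -> bool) (e G : dtree) : bool :=
  all (fun s => q (pexpr e s)) (envs (enumT n n) (ptyping G)).

Definition pcheck (c : nat) (q : cv -> bool) (e G : dtree) : bool :=
  pcheck_bounded (pcbound c e G) q e G.

Definition instance_arg (d : dtree) (i : nat) : dtree := nth Dnil (dlist d) i.

(** [1] is [csz None], and the conjunct [true] makes the predicate convertible to [accept None]. *)
Definition check1 (d : dtree) : bool :=
  pcheck 1 (fun v => andb (negb (eqn (tag v) 4)) true)
    (instance_arg d 0) (instance_arg d 1).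

Definition check2 (d : dtree) : bool :=
  pcheck (dsize (instance_arg d 2))
    (fun v => andb (negb (eqn (tag v) 4)) (ptype (instance_arg d 2) v))
    (instance_arg d 0) (instance_arg d 1).

Lemma real_ptyping : Real ptyping.
Proof. by rewrite /ptyping; creal. Qed.

#[export] Hint Resolve real_ptyping : real.

Lemma real_pcbound : Real pcbound.
Proof. by rewrite /pcbound; creal. Qed.

Lemma real_pcheck_bounded : Real pcheck_bounded.
Proof. by rewrite /pcheck_bounded; creal. Qed.

#[export] Hint Resolve real_pcbound real_pcheck_bounded : real.

Lemma real_pcheck : Real pcheck.
Proof. by rewrite /pcheck; creal. Qed.

Lemma real_instance_arg : Real instance_arg.
Proof. by rewrite /instance_arg; creal. Qed.

#[export] Hint Resolve real_pcheck real_instance_arg : real.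

Lemma real_check1 : Real check1.
Proof. by rewrite /check1; creal. Qed.

Lemma real_check2 : Real check2.
Proof. by rewrite /check2; creal. Qed.

Definition bindings (G : tassign) : seq (nat * rxtype) :=
  pmap (fun x => omap (fun t => (x, t)) (G.[? x])%fmap) (sort leq (domf G)).

Lemma dtassignE G :
  dtassign G = dseq [seq Dcons (dnat xt.1) (dtype xt.2) | xt <- bindings G].
Proof.
rewrite /dtassign /bindings; congr dseq.
elim: (sort _ _) => //= x l IH.
by case: (G.[? x])%fmap => [t|] //=; rewrite IH.
Qed.

Lemma In_bindings (G : tassign) (x : nat) (u : rxtype) :
  (G.[? x])%fmap = Some u <-> List.In (x, u) (bindings G).
Proof.
rewrite /bindings; split=> [Gx|].
  have : x \in sort leq (domf G) by rewrite mem_sort -fndSome Gx.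
  elim: (sort _ _) => //= y l IH; rewrite inE => /predU1P[<-|/IH{}IH].
    by rewrite Gx; left.
  by case: (G.[? y])%fmap => [t|] //=; right.
elim: (sort _ _) => //= y l IH; case E : (G.[? y])%fmap => [t|] //=.
by case=> [[<- <-]|].
Qed.

Lemma uniq_bindings G : uniq (map fst (bindings G)).
Proof.
have : uniq (sort leq (domf G)) by rewrite sort_uniq fset_uniq.
rewrite /bindings; elim: (sort _ _) => //= x l IH /andP[xl /IH{}IH].
case: (G.[? x])%fmap => [t|] //=; rewrite IH andbT.
apply: contra xl; elim: (l) => //= y l' IHl.
case: (G.[? y])%fmap => [t'|] /=; last by move/IHl; rewrite inE orbC => ->.
by rewrite !inE => /orP[->|/IHl ->] //; rewrite orbT.
Qed.

Lemma pcheckE e G t : pcheck (csz t) (accept t) (dexpr e) (dtassign G) =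
  (fun n => all (fun s => accept t (ceval e s))
                (envs (enumT n n) (typing (bindings G))))
  (cbound e (bindings G) t).
Proof.
rewrite /pcheck /pcheck_bounded dtassignE pexprE.
have -> : ptyping (dseq [seq Dcons (dnat xt.1) (dtype xt.2) | xt <- bindings G]) =
    typing (bindings G).
  rewrite /ptyping /typing dlistK -map_comp; apply: eq_map => -[x u] /=.
  by rewrite dtonK ptypeE.
have -> // : pcbound (csz t) (dexpr e)
    (dseq [seq Dcons (dnat xt.1) (dtype xt.2) | xt <- bindings G]) =
    cbound e (bindings G) t.
rewrite /pcbound /cbound pbndE dlistK; congr (_ * _); congr S.
by elim: (bindings G) => //= b l ->.
Qed.

Lemma nat_bijection (S : set nat) : infinite_set S ->
  exists (f : nat -> set_type S) (g : set_type S -> nat), cancel f g /\ cancel g f.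
Proof.
move=> infS.
have : ([set: nat] #= S)%card.
  rewrite card_eq_le (subset_card_le (@subsetT _ S)) andbT.
  exact/infiniteP.
case/card_set_bijP=> h [hS hinj hsurj].
have hS' n : h n \in S by apply: mem_set; exact: hS.
exists (fun n => SigSub (hS' n)).
have /choice[k kP] : forall a : set_type S, exists n, h n = val a.
  by move=> a; have [n _ e] := hsurj (val a) (set_mem (valP a)); exists n.
exists k; split=> [n|a]; last by apply: val_inj; exact: kP.
by apply: hinj; rewrite ?inE // kP.
Qed.

Lemma decidable_real (X : Type) (code : X -> dtree) (D P : X -> Prop)
    (q : dtree -> bool) :
  Real q -> (forall x, D x -> q (code x) <-> P x) -> decidable_on code D P.
Proof.
move=> [t [/andP[ct _] Ht]] qP; exists t => // x Dx; exists (q (code x)).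
  by have [v ev <-] := Ht (code x) _ erefl.
exact: qP.
Qed.

Theorem mainTheorem7 (S : set nat)
    (reS : recursively_enumerable S) (infS : infinite_set S) :
  decidable_on dinstance1
    (fun p => tassign_on p.1 p.2)
    (fun p => well_defined (set_type S) p.1 p.2) /\
  decidable_on dinstance2
    (fun p => tassign_on p.1.1 p.1.2 /\ well_defined (set_type S) p.1.1 p.1.2)
    (fun p => well_typed (set_type S) p.1.1 p.1.2 p.2).
Proof.
have [f [g [fK gK]]] := nat_bijection infS; split.
  apply: (decidable_real real_check1) => -[e G] /= GFV.
  rewrite [check1 _](pcheckE e G None).
  rewrite (check_envs fK gK (@In_bindings G) (uniq_bindings G) GFV (leqnn _)).
  by split=> H st /H [v ev]; exists v.
apply: (decidable_real real_check2) => -[[e G] t] /= [GFV _].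
have -> : check2 (dinstance2 (e, G, t)) =
    pcheck (csz (Some t)) (accept (Some t)) (dexpr e) (dtassign G).
  rewrite /check2 /dinstance2 /instance_arg dlistK [nth _ _ _]/= [nth _ _ _]/= [nth _ _ _]/=.
  by rewrite ptypeE.
rewrite pcheckE.
by rewrite (check_envs fK gK (@In_bindings G) (uniq_bindings G) GFV (leqnn _)).
Qed.
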